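(* Let $L,d,n$ be positive integers and $\rho>0$. Let $\mathbb{X}=(X_1,\dots,X_L)$ where $X_i$ are $n\times n$ centered complex random matrices, and assume $\mathbb{X}$, viewed as a random vector in $\mathbb{R}^{2n^2L}$ (identifying $\mathbb{C}$ with $\mathbb{R}^2$), satisfies the subgaussian concentration property with constant $\rho$. Let $P\colon(\mathbb{C}^{n\times n})^L\to\mathbb{C}^{n\times n}$ be a non-commutative polynomial of degree $d$ of the form $$P(x_1,\dots,x_L)=\sum_{k=0}^d\sum_{\mathbf{i}=(i_1,\dots,i_k)\in[L]^k}\sum_{\varepsilon\in\{1,\ast\}^k}A^{(0)}_{k,\mathbf{i},\varepsilon}x_{i_1}^{\varepsilon_1}A^{(1)}_{k,\mathbf{i},\varepsilon}x_{i_2}^{\varepsilon_2}\cdots A^{(k-1)}_{k,\mathbf{i},\varepsilon}x_{i_k}^{\varepsilon_k}A^{(k)}_{k,\mathbf{i},\varepsilon},$$ where the $A^{(j)}_{k,\mathbf{i},\varepsilon}$ are deterministic $n\times n$ complex matrices with operator norm at most $1$. Let $\mathbb{Y}=P(n^{-1/2}\mathbb{X})$. Then for every $F\colon\mathbb{C}^{n\times n}\to\mathbb{R}$, $1$-Lipschitz with respect to the Hilbert--Schmidt norm, and every $t>0$, $$\mathbb{P}(|F(\mathbb{Y})-\mathrm{Med}\,F(\mathbb{Y})|\ge t)\le2\exp\big(-cn\min(t^2,t^{2/d})\big),$$ where $c>0$ depends only on $d,L,\rho$.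
   Context: $x^1=x$ and $x^\ast=\bar x^T$ (conjugate transpose). A random vector $Y$ in $\mathbb{R}^M$ satisfies the subgaussian concentration property with constant $\rho$ if for every $G\colon\mathbb{R}^M\to\mathbb{R}$, $1$-Lipschitz with respect to the Euclidean norm, and every $t>0$, $\mathbb{P}(|G(Y)-\mathrm{Med}\,G(Y)|\ge t)\le2e^{-t^2/\rho^2}$, $\mathrm{Med}$ any median. The Hilbert--Schmidt norm on $\mathbb{C}^{n\times n}$ is $\|x\|_{HS}=(\sum_{ij}|x_{ij}|^2)^{1/2}$. Centered means all entries have mean zero. $[L]=\{1,\dots,L\}$. *)

(* Defs.v *)
From HB Require Import structures.
From mathcomp Require Import all_boot all_order all_algebra.
From mathcomp Require Import complex.
From mathcomp Require Import all_classical all_reals all_analysis.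
Set Implicit Arguments. Unset Strict Implicit. Unset Printing Implicit Defensive.
Import Order.TTheory GRing.Theory Num.Theory.
Import numFieldNormedType.Exports.
Local Open Scope classical_set_scope.
Local Open Scope ring_scope.

Section Defs.
Variable R : realType.
Local Notation C := (complex R).

Definition csq (z : C) : R := complex.Re z ^+ 2 + complex.Im z ^+ 2.

Definition hs_norm m p (A : 'M[C]_(m, p)) : R :=
  Num.sqrt (\sum_(i < m) \sum_(j < p) csq (A i j)).

Definition op_norm m p (A : 'M[C]_(m, p)) : R :=
  sup [set hs_norm (A *m v) | v in [set v : 'cV[C]_p | hs_norm v <= 1]].

Definition ctrmx n (A : 'M[C]_n) : 'M[C]_n := \matrix_(i, j) conjc (A j i).

Definition mxpow n (A : 'M[C]_n) (eps : bool) : 'M[C]_n :=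
  if eps then ctrmx A else A.

Definition nc_monomial n L k (A : 'I_k.+1 -> 'M[C]_n)
    (ii : {ffun 'I_k -> 'I_L}) (eps : {ffun 'I_k -> bool})
    (x : 'I_L -> 'M[C]_n) : 'M[C]_n :=
  A ord0 *m \big[@mulmx C n n n / 1%:M]_(j < k)
              (mxpow (x (ii j)) (eps j) *m A (lift ord0 j)).

Definition nc_coeffs n L d :=
  forall k : 'I_d.+1, {ffun 'I_k -> 'I_L} -> {ffun 'I_k -> bool} ->
    'I_k.+1 -> 'M[C]_n.

Definition nc_poly n L d (A : nc_coeffs n L d) (x : 'I_L -> 'M[C]_n) : 'M[C]_n :=
  \sum_(k < d.+1) \sum_(ii : {ffun 'I_k -> 'I_L}) \sum_(eps : {ffun 'I_k -> bool})
     nc_monomial (A k ii eps) ii eps x.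

Definition tuple_dist n L (x y : 'I_L -> 'M[C]_n) : R :=
  Num.sqrt (\sum_(l < L) \sum_(a < n) \sum_(b < n) csq (x l a b - y l a b)).

Definition is_median (dT : measure_display) (T : measurableType dT)
    (P : probability T R) (Z : T -> R) (m : R) : Prop :=
  (P [set w | (Z w <= m)%R] >= (2^-1)%:E)%E /\ (P [set w | (Z w >= m)%R] >= (2^-1)%:E)%E.

Definition subgauss_conc (dT : measure_display) (T : measurableType dT)
    (P : probability T R) n L (X : T -> 'I_L -> 'M[C]_n) (rho : R) : Prop :=
  forall (G : ('I_L -> 'M[C]_n) -> R),
    (forall x y, `|G x - G y| <= tuple_dist x y) ->
    forall t : R, 0 < t -> forall med : R, is_median P (G \o X) med ->
      (P [set w | (`|G (X w) - med| >= t)%R] <= (2 * expR (- t ^+ 2 / rho ^+ 2))%:E)%E.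

End Defs.

(* Main.v *)
(* The polynomial is Lipschitz only on sets of matrices with bounded operator
   norm, so fix a level kappa >= 1. On {|x_l|_op <= kappa sqrt n} the map
   x |-> P(n^{-1/2} x) is O(kappa^{d-1} n^{-1/2})-Lipschitz; extending F o P from
   this set to a globally Lipschitz function (McShane), the hypothesis bounds the
   deviations of the extension by exp(- c n s^2 / kappa^{2d-2}). The complement of
   the set has probability at most exp(- c n kappa^2): for unit u, v the variable
   Re <X_l u, v> is 1-Lipschitz in X and centered, so its median is O(rho), and
   u, v may be restricted to a net of size exp(O(n)). Taking kappa of order
   max(1, s^{1/d}) makes both bounds at most exp(- c n min(s^2, s^{2/d})). Passing
   to the median of F(Y) costs a factor 2 in s, and the numerical prefactor is
   absorbed by decreasing c. *)
Require Import Defs.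
From HB Require Import structures.
From mathcomp Require Import all_boot all_order all_algebra.
From mathcomp Require Import complex.
From mathcomp Require Import all_classical all_reals all_analysis.
From mathcomp Require Import measurable_realfun.
From mathcomp Require Import ring lra.
Set Implicit Arguments.
Unset Strict Implicit.
Unset Printing Implicit Defensive.
Import Order.TTheory GRing.Theory Num.Theory.
Import numFieldNormedType.Exports.
Local Open Scope classical_set_scope.
Local Open Scope ring_scope.

(** * Hilbert-Schmidt norm and operator bounds *)

Section EuclideanNorm.
Context {R : realType} {I : finType}.
Implicit Types f g : I -> R.

Definition l2dot f g : R := \sum_i f i * g i.
Definition l2norm f : R := Num.sqrt (\sum_i f i ^+ 2).

Lemma l2norm_ge0 f : 0 <= l2norm f.
Proof. exact: sqrtr_ge0. Qed.

Lemma l2norm_sqr f : l2norm f ^+ 2 = \sum_i f i ^+ 2.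
Proof. by rewrite sqr_sqrtr // sumr_ge0 // => i _; rewrite sqr_ge0. Qed.

Lemma l2norm_eq0 f i : l2norm f = 0 -> f i = 0.
Proof.
move=> f0; have /eqP : \sum_j f j ^+ 2 = 0 by rewrite -l2norm_sqr f0 expr0n.
rewrite psumr_eq0; last by move=> j _; rewrite sqr_ge0.
by move=> /allP /(_ i (mem_index_enum i)) /=; rewrite sqrf_eq0 => /eqP.
Qed.

(** Cauchy-Schwarz: with [a], [b] the norms of [f], [g], the squares [(b * f i - a * g i) ^+ 2] sum
    to [2ab(ab - l2dot f g)]. Dividing by [ab] requires zero norms to be treated first. *)
Lemma l2dot_le f g : l2dot f g <= l2norm f * l2norm g.
Proof.
have [f0|fN0] := eqVneq (l2norm f) 0.
  by rewrite f0 mul0r /l2dot big1 // => i _; rewrite (l2norm_eq0 i f0) mul0r.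
have [g0|gN0] := eqVneq (l2norm g) 0.
  by rewrite g0 mulr0 /l2dot big1 // => i _; rewrite (l2norm_eq0 i g0) mulr0.
set a := l2norm f; set b := l2norm g.
have a0 : 0 < a by rewrite lt_def fN0 l2norm_ge0.
have b0 : 0 < b by rewrite lt_def gN0 l2norm_ge0.
have : 0 <= \sum_i (b * f i - a * g i) ^+ 2 by rewrite sumr_ge0 // => i _; rewrite sqr_ge0.
have -> : \sum_i (b * f i - a * g i) ^+ 2 =
    b ^+ 2 * (\sum_i f i ^+ 2) - 2 * a * b * l2dot f g + a ^+ 2 * (\sum_i g i ^+ 2).
  rewrite /l2dot !mulr_sumr -sumrN -!big_split /=; apply: eq_bigr => i _; ring.
rewrite -!l2norm_sqr -/a -/b.
have -> : b ^+ 2 * a ^+ 2 - 2 * a * b * l2dot f g + a ^+ 2 * b ^+ 2 =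
   (2 * (a * b)) * (a * b - l2dot f g) by ring.
by rewrite pmulr_rge0 ?subr_ge0 // !mulr_gt0.
Qed.

Lemma l2norm_triangle f g : l2norm (fun i => f i + g i) <= l2norm f + l2norm g.
Proof.
rewrite -(@ler_pXn2r _ 2) ?nnegrE ?addr_ge0 ?l2norm_ge0 // l2norm_sqr.
have -> : \sum_i (f i + g i) ^+ 2 = \sum_i f i ^+ 2 + l2dot f g *+ 2 + \sum_i g i ^+ 2.
  rewrite /l2dot -sumrMnl -!big_split /=; apply: eq_bigr => i _; ring.
rewrite -!l2norm_sqr sqrrD lerD2r lerD2l lerMn2r //=; exact: l2dot_le.
Qed.

Lemma l2normZ c f : l2norm (fun i => c * f i) = `|c| * l2norm f.
Proof.
rewrite /l2norm -[`|c|]sqrtr_sqr -sqrtrM ?sqr_ge0 // mulr_sumr.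
by congr Num.sqrt; apply: eq_bigr => i _; rewrite exprMn.
Qed.

Lemma eq_l2norm f g : f =1 g -> l2norm f = l2norm g.
Proof. by move=> fg; congr Num.sqrt; apply: eq_bigr => i _; rewrite fg. Qed.

Lemma l2norm_le_sum f : l2norm f <= \sum_i `|f i|.
Proof.
rewrite -(@ler_pXn2r _ 2) ?nnegrE ?l2norm_ge0 ?sumr_ge0 // l2norm_sqr.
rewrite expr2 mulr_suml ler_sum // => i _.
rewrite -real_normK ?num_real // expr2 ler_wpM2l // (bigD1 i) //= lerDl.
by rewrite sumr_ge0.
Qed.

Lemma coord_le_l2norm f i : `|f i| <= l2norm f.
Proof.
rewrite -(@ler_pXn2r _ 2) ?nnegrE ?l2norm_ge0 // l2norm_sqr real_normK ?num_real //.
by rewrite (bigD1 i) //= lerDl sumr_ge0 // => j _; rewrite sqr_ge0.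
Qed.

End EuclideanNorm.

Section HilbertSchmidt.
Context {R : realType}.
Local Notation C := (complex R).

Definition ccoord (b : bool) (z : C) : R := if b then complex.Im z else complex.Re z.

Definition mxcoord m p (A : 'M[C]_(m, p)) (k : 'I_m * 'I_p * bool) : R :=
  ccoord k.2 (A k.1.1 k.1.2).

Lemma csqE z : csq z = \sum_(b : bool) ccoord b z ^+ 2.
Proof. by rewrite big_bool /= addrC. Qed.

Lemma ccoordD b (x y : C) : ccoord b (x + y) = ccoord b x + ccoord b y.
Proof. by case: b x y => [] [a1 b1] [a2 b2]. Qed.

Lemma ccoordN b (x : C) : ccoord b (- x) = - ccoord b x.
Proof. by case: b x => [] [a1 b1]. Qed.

Lemma ccoordZ b (r : R) (x : C) : ccoord b (r%:C%C * x) = r * ccoord b x.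
Proof. by case: b x => [] [a1 b1] /=; rewrite mul0r ?subr0 ?addr0. Qed.

Lemma csqM (x y : C) : csq (x * y) = csq x * csq y.
Proof. by case: x y => [a b] [c e]; rewrite /csq /=; ring. Qed.

Lemma csqJ (x : C) : csq (conjc x) = csq x.
Proof. by case: x => [a b]; rewrite /csq /= sqrrN. Qed.

Lemma csq_ge0 (x : C) : 0 <= csq x.
Proof. by rewrite addr_ge0 ?sqr_ge0. Qed.

Context {m p : nat}.
Implicit Types A B : 'M[C]_(m, p).

(** Real part of the Hilbert-Schmidt inner product (see [rdotE]); being real, it is a linear form in
    the real coordinates, to which concentration applies. *)
Definition rdot A B : R := l2dot (mxcoord A) (mxcoord B).

Lemma hs_normE A : hs_norm A = l2norm (mxcoord A).
Proof.
rewrite /hs_norm /l2norm -(pair_bigA _ (fun k b => ccoord b (A k.1 k.2) ^+ 2)) /=.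
rewrite -(pair_bigA _ (fun i j => \sum_b ccoord b (A i j) ^+ 2)) /=.
by congr Num.sqrt; apply: eq_bigr => i _; apply: eq_bigr => j _; rewrite csqE.
Qed.

Lemma hs_norm_sqr A : hs_norm A ^+ 2 = rdot A A.
Proof. by rewrite hs_normE l2norm_sqr; apply: eq_bigr. Qed.

Lemma hs_norm_sqrE A : hs_norm A ^+ 2 = \sum_i \sum_j csq (A i j).
Proof. by rewrite sqr_sqrtr //; do 2!(rewrite sumr_ge0 // => ? _); apply: csq_ge0. Qed.

Lemma hs_norm_ge0 A : 0 <= hs_norm A.
Proof. exact: sqrtr_ge0. Qed.

Lemma rdot_le A B : rdot A B <= hs_norm A * hs_norm B.
Proof. by rewrite !hs_normE l2dot_le. Qed.

Lemma hs_normD A B : hs_norm (A + B) <= hs_norm A + hs_norm B.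
Proof.
rewrite !hs_normE; apply: le_trans (l2norm_triangle _ _).
by rewrite le_eqVlt; apply/orP; left; apply/eqP/eq_l2norm => k; rewrite /mxcoord mxE ccoordD.
Qed.

Lemma hs_normZ (r : R) A : hs_norm (r%:C%C *: A) = `|r| * hs_norm A.
Proof.
by rewrite !hs_normE -l2normZ; apply: eq_l2norm => k; rewrite /mxcoord mxE ccoordZ.
Qed.

Lemma hs_normN A : hs_norm (- A) = hs_norm A.
Proof.
rewrite !hs_normE /l2norm; congr Num.sqrt; apply: eq_bigr => k _.
by rewrite /mxcoord mxE ccoordN sqrrN.
Qed.

Lemma hs_norm0 : hs_norm (0 : 'M[C]_(m, p)) = 0.
Proof.
rewrite /hs_norm big1 ?sqrtr0 // => i _; rewrite big1 // => j _.
by rewrite mxE /csq /= expr0n addr0.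
Qed.

Lemma hs_norm_eq0 A : hs_norm A = 0 -> A = 0.
Proof.
rewrite hs_normE => A0; apply/matrixP => i j; rewrite mxE.
have := l2norm_eq0 (i, j, false) A0; have := l2norm_eq0 (i, j, true) A0.
by rewrite /mxcoord /=; case: (A i j) => a b /= -> ->.
Qed.

Lemma hs_norm_sum I (r : seq I) (P : pred I) (F : I -> 'M[C]_(m, p)) :
  hs_norm (\sum_(i <- r | P i) F i) <= \sum_(i <- r | P i) hs_norm (F i).
Proof.
elim/big_rec2: _ => [|i x y _ h]; first by rewrite hs_norm0.
by apply: le_trans (hs_normD _ _) _; rewrite lerD2l.
Qed.

Lemma rdotDl A A' B : rdot (A + A') B = rdot A B + rdot A' B.
Proof.
rewrite /rdot /l2dot -big_split /=; apply: eq_bigr => k _.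
by rewrite /mxcoord mxE ccoordD mulrDl.
Qed.

Lemma rdotC A B : rdot A B = rdot B A.
Proof. by apply: eq_bigr => k _; rewrite mulrC. Qed.

Lemma rdotNl A B : rdot (- A) B = - rdot A B.
Proof.
rewrite /rdot /l2dot -sumrN; apply: eq_bigr => k _.
by rewrite /mxcoord mxE ccoordN mulNr.
Qed.

Lemma rdotZl (r : R) A B : rdot (r%:C%C *: A) B = r * rdot A B.
Proof.
rewrite /rdot /l2dot mulr_sumr; apply: eq_bigr => k _.
by rewrite /mxcoord mxE ccoordZ mulrA.
Qed.

Definition adjmx A : 'M[C]_(p, m) := map_mx conjc A^T.

Lemma rdotE A B : rdot A B = complex.Re (\tr (A *m adjmx B)).
Proof.
rewrite /rdot /l2dot -(pair_bigA _ (fun k b => ccoord b (A k.1 k.2) * ccoord b (B k.1 k.2))) /=.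
rewrite -(pair_bigA _ (fun i j => \sum_b ccoord b (A i j) * ccoord b (B i j))) /=.
rewrite /mxtrace (raddf_sum (@complex.Re R : Rcomplex R -> R)) /=.
apply: eq_bigr => i _.
rewrite mxE (raddf_sum (@complex.Re R : Rcomplex R -> R)) /=; apply: eq_bigr => j _.
by rewrite big_bool /= !mxE; case: (A i j) (B i j) => [a b] [c e] /=; ring.
Qed.

Lemma hs_norm_adj A : hs_norm (adjmx A) = hs_norm A.
Proof.
rewrite /hs_norm exchange_big /=; congr Num.sqrt.
by apply: eq_bigr => i _; apply: eq_bigr => j _; rewrite !mxE csqJ.
Qed.

End HilbertSchmidt.

Section OperatorBounds.
Context {R : realType}.
Local Notation C := (complex R).

Lemma adjmxM m p q (A : 'M[C]_(m, p)) (B : 'M[C]_(p, q)) :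
  adjmx (A *m B) = adjmx B *m adjmx A.
Proof. by rewrite /adjmx trmx_mul map_mxM. Qed.

Lemma adjmxK m p (A : 'M[C]_(m, p)) : adjmx (adjmx A) = A.
Proof. by apply/matrixP => i j; rewrite !mxE conjcK. Qed.

Lemma adjmxB m p (A B : 'M[C]_(m, p)) : adjmx (A - B) = adjmx A - adjmx B.
Proof. by apply/matrixP => i j; rewrite !mxE rmorphB. Qed.

Lemma ctrmxE n (A : 'M[C]_n) : ctrmx A = adjmx A.
Proof. by apply/matrixP => i j; rewrite !mxE. Qed.

Lemma rdot_mull m p q (A : 'M[C]_(m, p)) (B : 'M[C]_(p, q)) (D : 'M[C]_(m, q)) :
  rdot (A *m B) D = rdot B (adjmx A *m D).
Proof. by rewrite !rdotE adjmxM adjmxK -mulmxA mxtrace_mulC mulmxA. Qed.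

Lemma rdot_mulr m p q (A : 'M[C]_(m, p)) (B : 'M[C]_(p, q)) (D : 'M[C]_(m, q)) :
  rdot (A *m B) D = rdot A (D *m adjmx B).
Proof. by rewrite !rdotE adjmxM adjmxK mulmxA. Qed.

Lemma hs_norm_outer m p (u : 'cV[C]_m) (v : 'cV[C]_p) :
  hs_norm (u *m adjmx v) = hs_norm u * hs_norm v.
Proof.
apply/eqP; rewrite -(@eqrXn2 _ 2) ?mulr_ge0 ?hs_norm_ge0 // exprMn !hs_norm_sqrE.
rewrite mulr_suml; apply/eqP; apply: eq_bigr => i _.
rewrite big_ord1 mulr_sumr; apply: eq_bigr => j _.
by rewrite big_ord1 mxE big_ord1 csqM !mxE csqJ.
Qed.

(** [A v] paired with itself is [A] paired with the rank-one matrix [(A v) v*], so Cauchy-Schwarz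
    leaves one factor [hs_norm (A *m v)] to cancel. *)
Lemma hs_norm_mulv m p (A : 'M[C]_(m, p)) (v : 'cV[C]_p) :
  hs_norm (A *m v) <= hs_norm A * hs_norm v.
Proof.
have [->|N0] := eqVneq (hs_norm (A *m v)) 0; first by rewrite mulr_ge0 ?hs_norm_ge0.
have p0 : 0 < hs_norm (A *m v) by rewrite lt_def N0 hs_norm_ge0.
rewrite -(ler_pM2r p0) -expr2 hs_norm_sqr rdot_mulr.
by apply: le_trans (rdot_le _ _) _; rewrite hs_norm_outer mulrCA mulrC -!mulrA [hs_norm v * _]mulrC.
Qed.

(** Homogeneous form of an operator-norm bound, free of the supremum, so that it passes directly to
    products and adjoints. *)
Definition op_bounded m p (A : 'M[C]_(m, p)) (K : R) :=
  forall v : 'cV[C]_p, hs_norm (A *m v) <= K * hs_norm v.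

Lemma op_boundedM m p q (A : 'M[C]_(m, p)) (B : 'M[C]_(p, q)) a b :
  0 <= a -> op_bounded A a -> op_bounded B b -> op_bounded (A *m B) (a * b).
Proof.
move=> a0 hA hB v; rewrite -mulmxA; apply: le_trans (hA _) _.
by rewrite -mulrA ler_wpM2l.
Qed.

Lemma op_bounded1 n : op_bounded (1%:M : 'M[C]_n) 1.
Proof. by move=> v; rewrite mul1mx mul1r. Qed.

Lemma hs_norm_col m p (A : 'M[C]_(m, p)) :
  hs_norm A ^+ 2 = \sum_j hs_norm (col j A) ^+ 2.
Proof.
rewrite hs_norm_sqrE exchange_big; apply: eq_bigr => j _.
by rewrite hs_norm_sqrE; apply: eq_bigr => i _; rewrite big_ord1 mxE.
Qed.

(** The squared Hilbert-Schmidt norm is a sum over columns, and left multiplication acts on each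
    column separately. *)
Lemma hs_norm_mul_opl m p q (A : 'M[C]_(m, p)) (B : 'M[C]_(p, q)) a :
  0 <= a -> op_bounded A a -> hs_norm (A *m B) <= a * hs_norm B.
Proof.
move=> a0 hA; rewrite -(@ler_pXn2r _ 2) ?nnegrE ?mulr_ge0 ?hs_norm_ge0 //.
rewrite exprMn !hs_norm_col mulr_sumr ler_sum // => j _.
by rewrite -exprMn ler_pXn2r ?nnegrE ?mulr_ge0 ?hs_norm_ge0 // !colE -mulmxA -colE.
Qed.

(** [|A* v|^2 = <v, A A* v> <= |v| a |A* v|], and one factor [|A* v|] cancels. *)
Lemma op_bounded_adj m p (A : 'M[C]_(m, p)) a :
  0 <= a -> op_bounded A a -> op_bounded (adjmx A) a.
Proof.
move=> a0 hA v.
have [->|N0] := eqVneq (hs_norm (adjmx A *m v)) 0; first by rewrite mulr_ge0 ?hs_norm_ge0.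
have p0 : 0 < hs_norm (adjmx A *m v) by rewrite lt_def N0 hs_norm_ge0.
rewrite -(ler_pM2r p0) -expr2 hs_norm_sqr rdot_mull adjmxK rdotC.
apply: le_trans (rdot_le _ _) _.
by rewrite mulrAC ler_wpM2r ?hs_norm_ge0.
Qed.

Lemma hs_norm_mul_opr m p q (A : 'M[C]_(m, p)) (B : 'M[C]_(p, q)) b :
  0 <= b -> op_bounded B b -> hs_norm (A *m B) <= b * hs_norm A.
Proof.
move=> b0 hB; rewrite -hs_norm_adj adjmxM -(hs_norm_adj A).
exact/hs_norm_mul_opl/op_bounded_adj.
Qed.

Lemma op_bounded_scale m p (A : 'M[C]_(m, p)) a (r : R) :
  0 <= r -> op_bounded A a -> op_bounded (r%:C%C *: A) (r * a).
Proof.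
by move=> r0 hA v; rewrite -scalemxAl hs_normZ ger0_norm // -mulrA ler_wpM2l.
Qed.

Let ball_image m p (A : 'M[C]_(m, p)) : set R :=
  [set hs_norm (A *m v) | v in [set v : 'cV[C]_p | hs_norm v <= 1]].

Let has_sup_ball_image m p (A : 'M[C]_(m, p)) : has_sup (ball_image A).
Proof.
split; first by exists (hs_norm (A *m (0 : 'cV_p))), 0 => //=; rewrite hs_norm0.
exists (hs_norm A) => _ [v /= v1 <-]; apply: le_trans (hs_norm_mulv _ _) _.
by rewrite ler_piMr ?hs_norm_ge0.
Qed.

Lemma op_norm_bounded m p (A : 'M[C]_(m, p)) : op_bounded A (op_norm A).
Proof.
move=> v; have [v0|N0] := eqVneq (hs_norm v) 0.
  by rewrite (hs_norm_eq0 v0) mulmx0 !hs_norm0 mulr0.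
have p0 : 0 < hs_norm v by rewrite lt_def N0 hs_norm_ge0.
rewrite -ler_pdivrMr // mulrC.
have i0 : 0 <= (hs_norm v)^-1 by rewrite invr_ge0 hs_norm_ge0.
rewrite -[X in X * _](ger0_norm i0) -hs_normZ scalemxAr.
apply: (sup_ubound (proj2 (has_sup_ball_image A))).
by exists (((hs_norm v)^-1)%:C%C *: v) => //=; rewrite hs_normZ ger0_norm // mulVf.
Qed.

Lemma op_norm_ge0 m p (A : 'M[C]_(m, p)) : 0 <= op_norm A.
Proof.
apply: le_trans (sup_ubound (proj2 (has_sup_ball_image A)) _); last first.
  by exists 0 => /=; rewrite ?hs_norm0.
by rewrite hs_norm_ge0.
Qed.

Lemma op_norm_le m p (A : 'M[C]_(m, p)) K :
  (forall v : 'cV[C]_p, hs_norm v <= 1 -> hs_norm (A *m v) <= K) -> op_norm A <= K.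
Proof.
move=> h; apply: ge_sup; first by case: (has_sup_ball_image A).
by move=> _ [v /= v1 <-]; exact: h.
Qed.

Lemma op_bounded_le m p (A : 'M[C]_(m, p)) a b :
  a <= b -> op_bounded A a -> op_bounded A b.
Proof. by move=> ab hA v; apply: le_trans (hA v) _; rewrite ler_wpM2r ?hs_norm_ge0. Qed.

End OperatorBounds.

(** [d] times the number of monomials, where [d] bounds the degree factor [k] in the Lipschitz
    constant of each monomial. It does not involve [n]. *)
Definition poly_lip {R : realType} (L d : nat) : R :=
  \sum_(k < d.+1) \sum_(ii : {ffun 'I_k -> 'I_L}) \sum_(eps : {ffun 'I_k -> bool}) d%:R.

Lemma poly_lip_ge0 {R : realType} (L d : nat) : 0 <= poly_lip L d :> R.
Proof. by do 3!(rewrite sumr_ge0 // => ? _). Qed.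

(** * Lipschitz bounds for polynomials on operator-norm balls *)

Section PolynomialLipschitz.
Context {R : realType} {n L : nat}.
Local Notation C := (complex R).

Lemma op_bounded_prod I (r : seq I) (B : I -> 'M[C]_n) (k : R) :
  0 <= k -> (forall j, op_bounded (B j) k) ->
  op_bounded (\big[@mulmx C n n n / 1%:M]_(j <- r) B j) (k ^+ size r).
Proof.
move=> k0 hB; elim: r => [|j r IH]; first by rewrite big_nil; exact: op_bounded1.
by rewrite big_cons exprS; apply: op_boundedM.
Qed.

(** Telescoping: [B j] is exchanged for [B' j] one factor at a time. Each of the [size r] terms has
    one difference, measured in Hilbert-Schmidt norm, and otherwise factors bounded in operator
    norm. *)
Lemma hs_norm_prodB I (r : seq I) (B B' : I -> 'M[C]_n) (k D : R) :
  0 <= k -> (forall j, op_bounded (B j) k) -> (forall j, op_bounded (B' j) k) ->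
  (forall j, hs_norm (B j - B' j) <= D) ->
  hs_norm (\big[@mulmx C n n n / 1%:M]_(j <- r) B j -
           \big[@mulmx C n n n / 1%:M]_(j <- r) B' j)
    <= (size r)%:R * k ^+ (size r).-1 * D.
Proof.
move=> k0 hB hB' hD; elim: r => [|j r IH].
  by rewrite !big_nil subrr hs_norm0 /= !mul0r.
rewrite !big_cons; set p := (X in B j *m X); set p' := (X in B' j *m X).
have -> : B j *m p - B' j *m p' = B j *m (p - p') + (B j - B' j) *m p'.
  by rewrite mulmxBr mulmxBl addrA subrK.
apply: le_trans (hs_normD _ _) _ => /=.
have h1 : hs_norm (B j *m (p - p')) <= k * ((size r)%:R * k ^+ (size r).-1 * D).
  by apply: le_trans (hs_norm_mul_opl _ k0 (hB j)) _; rewrite ler_wpM2l.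
have h2 : hs_norm ((B j - B' j) *m p') <= k ^+ size r * D.
  apply: le_trans (hs_norm_mul_opr _ (exprn_ge0 (size r) k0) _) _.
    exact: op_bounded_prod.
  by rewrite ler_wpM2l ?exprn_ge0.
apply: le_trans (lerD h1 h2) _; rewrite le_eqVlt; apply/orP; left; apply/eqP.
by case: (size r) => [|s]; rewrite /= ?expr0 ?[in RHS]mulrS ?exprS; ring.
Qed.

Lemma op_bounded_mxpow (x : 'M[C]_n) e k :
  0 <= k -> op_bounded x k -> op_bounded (mxpow x e) k.
Proof. by move=> k0; case: e => //= hx; rewrite ctrmxE; exact: op_bounded_adj. Qed.

Lemma hs_norm_mxpowB (x y : 'M[C]_n) e :
  hs_norm (mxpow x e - mxpow y e) = hs_norm (x - y).
Proof. by case: e => //=; rewrite !ctrmxE -adjmxB hs_norm_adj. Qed.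

Lemma hs_norm_monomialB k (A : 'I_k.+1 -> 'M[C]_n) (ii : {ffun 'I_k -> 'I_L})
    (eps : {ffun 'I_k -> bool}) (x y : 'I_L -> 'M[C]_n) (K D : R) :
  0 <= K -> (forall j, op_bounded (A j) 1) ->
  (forall l, op_bounded (x l) K) -> (forall l, op_bounded (y l) K) ->
  (forall l, hs_norm (x l - y l) <= D) ->
  hs_norm (nc_monomial A ii eps x - nc_monomial A ii eps y) <= k%:R * K ^+ k.-1 * D.
Proof.
move=> K0 hA hx hy hD; rewrite /nc_monomial -mulmxBr.
apply: le_trans (hs_norm_mul_opl _ ler01 (hA _)) _; rewrite mul1r.
have sz : size (index_enum 'I_k) = k by rewrite -sum1_size big_const_ord iter_addn_0 mul1n.
rewrite -[in X in _ <= X]sz; apply: hs_norm_prodB => // j.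
- by rewrite -[K]mulr1; apply: op_boundedM => //; exact: op_bounded_mxpow.
- by rewrite -[K]mulr1; apply: op_boundedM => //; exact: op_bounded_mxpow.
rewrite -mulmxBl; apply: le_trans (hs_norm_mul_opr _ ler01 (hA _)) _.
by rewrite mul1r hs_norm_mxpowB.
Qed.

(** [1 <= K] lets [K ^+ d.-1] dominate the powers [K ^+ k.-1] of all degrees at once. *)
Lemma hs_norm_polyB d (A : nc_coeffs R n L d) (x y : 'I_L -> 'M[C]_n) (K D : R) :
  1 <= K -> 0 <= D -> (forall k ii eps j, op_bounded (A k ii eps j) 1) ->
  (forall l, op_bounded (x l) K) -> (forall l, op_bounded (y l) K) ->
  (forall l, hs_norm (x l - y l) <= D) ->
  hs_norm (nc_poly A x - nc_poly A y) <= poly_lip L d * K ^+ d.-1 * D.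
Proof.
move=> K1 D0 hA hx hy hD; have K0 : 0 <= K by apply: le_trans K1.
rewrite -mulrA /poly_lip mulr_suml /nc_poly -sumrB.
apply: le_trans (hs_norm_sum _ _ _) _; apply: ler_sum => k _.
rewrite mulr_suml -sumrB.
apply: le_trans (hs_norm_sum _ _ _) _; apply: ler_sum => ii _.
rewrite mulr_suml -sumrB.
apply: le_trans (hs_norm_sum _ _ _) _; apply: ler_sum => eps _.
apply: le_trans (hs_norm_monomialB _ _ K0 _ hx hy hD) _ => //.
have kd : (k <= d)%N by rewrite -ltnS.
rewrite mulrA ler_wpM2r // ler_pM ?ler0n ?exprn_ge0 ?ler_nat //.
by rewrite ler_weXn2l // -!subn1 leq_sub2r.
Qed.

End PolynomialLipschitz.

(** * A net of the unit ball *)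

Section LatticeNet.
Context {R : realType} {J : finType}.
Local Notation S := (16 * #|J|)%N.
Local Notation code := {ffun J -> bool * 'I_S.+1}.

(** A code stores a sign and a modulus for each coordinate of a lattice point; the condition says
    that this point, scaled by [net_step], lies in the unit ball. *)
Definition net_code (f : code) : bool := (\sum_j (f j).2 ^ 2 <= S)%N.

(** Mesh [(16 |J|)^(-1/2)]: an error of one mesh in each of [|J|] coordinates has Euclidean norm at
    most [1/4]. *)
Definition net_step : R := (Num.sqrt S%:R)^-1.

Definition net_point (f : code) (j : J) : R := net_step * ((-1) ^+ (f j).1 * (f j).2%:R).

Lemma net_step_sqr : net_step ^+ 2 = S%:R^-1.
Proof. by rewrite /net_step exprVn sqr_sqrtr. Qed.

Lemma net_point_norm f : net_code f -> l2norm (net_point f) <= 1.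
Proof.
move=> hf; rewrite -(@ler_pXn2r _ 2) ?nnegrE ?l2norm_ge0 // l2norm_sqr expr1n.
have -> : \sum_j net_point f j ^+ 2 = net_step ^+ 2 * (\sum_j (f j).2 ^ 2)%N%:R.
  rewrite natr_sum mulr_sumr; apply: eq_bigr => j _.
  by rewrite !exprMn sqrr_sign mul1r natrX.
rewrite net_step_sqr; have [->|S0] := eqVneq (S%:R : R) 0.
  by rewrite invr0 mul0r.
by rewrite mulrC ler_pdivrMr ?lt_def ?S0 ?ler0n // mul1r ler_nat.
Qed.

(* Each coordinate is rounded towards zero, so the rounded point stays in the ball. *)
Lemma net_approx (c : J -> R) : (0 < #|J|)%N -> l2norm c <= 1 ->
  exists2 f : code, net_code f & l2norm (fun j => c j - net_point f j) <= 4^-1.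
Proof.
move=> J0 c1.
have S0 : (0 < S)%N by rewrite muln_gt0.
have S0r : 0 < S%:R :> R by rewrite ltr0n.
have st0 : 0 < net_step by rewrite invr_gt0 sqrtr_gt0.
pose y j : R := `|c j| / net_step.
have y0 j : 0 <= y j by rewrite divr_ge0 // ltW.
pose k j := Num.truncn (y j).
have ky j : (k j)%:R <= y j by rewrite /k truncn_le.
have yk j : y j < (k j).+1%:R by apply: truncnS_gt.
have sumk : (\sum_j k j ^ 2 <= S)%N.
  rewrite -(ler_nat R) natr_sum.
  apply: (@le_trans _ _ (\sum_j S%:R * c j ^+ 2)).
    apply: ler_sum => j _; rewrite natrX.
    apply: (@le_trans _ _ (y j ^+ 2)); first by rewrite ler_pXn2r ?nnegrE.
    by rewrite expr_div_n net_step_sqr invrK real_normK ?num_real // mulrC.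
  rewrite -mulr_sumr -l2norm_sqr ler_piMr ?ler0n // expr_le1 ?l2norm_ge0 //.
(* A natural number is at most its square, so each modulus fits below [S.+1]. *)
have kS j : (k j < S.+1)%N.
  rewrite ltnS; apply: leq_trans sumk; rewrite (bigD1 j) //=.
  by apply: leq_trans (leq_addr _ _); case: (k j) => // m; rewrite leq_pmulr.
pose f : code := [ffun j => (c j < 0, Ordinal (kS j))].
exists f; first by rewrite /net_code; under eq_bigr do rewrite ffunE /=.
have dj j : `|c j - net_point f j| <= net_step.
  have -> : c j = (-1) ^+ (c j < 0)%R * `|c j|.
    by have := realEsign (num_real (c j)).
  rewrite /net_point ffunE /= mulrCA -mulrBr normrM normrX ?normrN1 ?expr1n ?mul1r.
  have -> : `|c j| = net_step * y j by rewrite /y mulrC divfK // gt_eqF.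
  rewrite -mulrBr normrM (gtr0_norm st0) ler_piMr ?(ltW st0) //.
  rewrite ger0_norm ?subr_ge0 // lerBlDl; apply: ltW.
  by have := yk j; rewrite -natr1.
rewrite -(@ler_pXn2r _ 2) ?nnegrE ?l2norm_ge0 ?invr_ge0 // l2norm_sqr.
apply: (@le_trans _ _ (\sum_(j : J) net_step ^+ 2)).
  apply: ler_sum => j _; rewrite -real_normK ?num_real //.
  by rewrite ler_pXn2r ?nnegrE // ltW.
rewrite sumr_const net_step_sqr (_ : #|_| = #|J|) // -[leLHS]mulr_natl natrM.
have : (#|J|%:R : R) != 0 by rewrite pnatr_eq0 -lt0n.
move: (#|J|%:R : R) => N N0; rewrite le_eqVlt; apply/orP; left; apply/eqP.
by field.
Qed.

(* Chernoff's trick: an admissible code has weight at least 1 once multiplied by 2^S. *)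
Lemma count_net_code : \sum_(f : code | net_code f) (1 : R) <= 2 ^+ (18 * #|J|)%N.
Proof.
pose w (m : nat) : R := 2^-1 ^+ m.
have w0 m : 0 <= w m by rewrite exprn_ge0.
have geo N : \sum_(i < N) w i <= 2.
  suff -> : \sum_(i < N) w i = 2 - 2 * w N by rewrite gerBl mulr_ge0.
  elim: N => [|N IH]; first by rewrite big_ord0 /w expr0; ring.
  by rewrite big_ord_recr /= IH /w exprS; field.
have step1 : \sum_(f : code | net_code f) (1 : R) <= 2 ^+ S * \sum_(f : code) \prod_j w (f j).2.
  apply: (@le_trans _ _ (\sum_(f : code | net_code f) 2 ^+ S * \prod_j w (f j).2)); last first.
    rewrite mulr_sumr [leRHS](bigID net_code) /= lerDl.
    by rewrite sumr_ge0 // => f _; rewrite mulr_ge0 ?exprn_ge0 ?prodr_ge0.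
  apply: ler_sum => f hf.
  rewrite /w prodrXr exprVn ler_pdivlMr ?exprn_gt0 // mul1r ler_weXn2l ?ler1n //.
  apply: leq_trans hf; apply: leq_sum => j _.
  by case: (nat_of_ord _) => // m; rewrite leq_pmulr.
apply: le_trans step1 _.
rewrite -(bigA_distr_bigA (fun j (bk : bool * 'I_S.+1) => w bk.2)) /=.
(* Two signs times a geometric series of sum at most 2: each coordinate contributes [2 ^+ 2], which
   adds [2 |J|] to the exponent [S = 16 |J|]. *)
have h4 : \sum_(bk : bool * 'I_S.+1) w bk.2 <= 2 ^+ 2.
  rewrite -(pair_bigA _ (fun (b : bool) (k : 'I_S.+1) => w k)) /= big_bool /=.
  by rewrite [leRHS](_ : _ = 2 + 2) ?lerD ?geo //; ring.
apply: (@le_trans _ _ (2 ^+ S * \prod_(j : J) 2 ^+ 2)).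
  rewrite ler_wpM2l ?exprn_ge0 //; apply: ler_prod => j _.
  by rewrite h4 sumr_ge0.
by rewrite prodr_const (_ : #|_| = #|J|) // -exprM -exprD -mulnDl.
Qed.

End LatticeNet.

Section NetOperatorNorm.
Context {R : realType} {n : nat}.
Local Notation C := (complex R).
Local Notation J := ('I_n * bool)%type.
Local Notation code := {ffun J -> bool * 'I_(16 * #|{: J}|).+1}.

Definition col_of_coords (c : J -> R) : 'cV[C]_n :=
  \col_i Complex (c (i, false)) (c (i, true)).

Lemma hs_norm_colE (v : 'cV[C]_n) :
  hs_norm v = l2norm (fun j : J => ccoord j.2 (v j.1 ord0)).
Proof.
rewrite /hs_norm /l2norm -(pair_bigA _ (fun i b => ccoord b (v i ord0) ^+ 2)) /=.
by congr Num.sqrt; apply: eq_bigr => i _; rewrite big_ord1 csqE.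
Qed.

Lemma ccoord_col_of_coords c (j : J) : ccoord j.2 (col_of_coords c j.1 ord0) = c j.
Proof. by case: j => i []; rewrite mxE. Qed.

Definition net_vec (f : code) : 'cV[C]_n := col_of_coords (net_point f).

Lemma hs_norm_net_vec f : net_code f -> hs_norm (net_vec f) <= 1.
Proof.
move=> hf; rewrite hs_norm_colE (eq_l2norm (ccoord_col_of_coords _)).
exact: net_point_norm.
Qed.

Lemma net_vec_approx (v : 'cV[C]_n) : (0 < n)%N -> hs_norm v <= 1 ->
  exists2 f, net_code f & hs_norm (v - net_vec f) <= 4^-1.
Proof.
move=> n0; rewrite hs_norm_colE => v1.
have [|f hf hv] := net_approx _ v1; first by rewrite card_prod card_ord card_bool muln_gt0 n0.
exists f => //; rewrite hs_norm_colE; apply: le_trans hv.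
rewrite le_eqVlt; apply/orP; left; apply/eqP/eq_l2norm => j.
by rewrite !mxE ccoordD ccoordN -[in RHS](ccoord_col_of_coords (net_point f)) mxE.
Qed.

(** Moving [v] and a dual vector [w] to the net costs [M / 4] each, so [M <= B + M / 2], and the
    last term is absorbed. *)
Lemma op_norm_net (A : 'M[C]_n) (B : R) : (0 < n)%N ->
  (forall f g, net_code f -> net_code g -> rdot (A *m net_vec f) (net_vec g) <= B) ->
  op_norm A <= 2 * B.
Proof.
move=> n0 hB; set M := op_norm A.
have M0 : 0 <= M := op_norm_ge0 A.
have bM (x y : 'cV[C]_n) a b : hs_norm x <= a -> hs_norm y <= b -> rdot (A *m x) y <= M * (a * b).
  move=> xa yb; apply: le_trans (rdot_le _ _) _; rewrite mulrA.
  apply: ler_pM; rewrite ?hs_norm_ge0 //.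
  by apply: le_trans (op_norm_bounded _ _) _; rewrite ler_wpM2l.
suff : M <= B + M / 2 by lra.
apply: op_norm_le => v v1.
(* [w] is the normalization of [A *m v], or 0 when this vanishes. *)
have [w w1 ->] : exists2 w : 'cV_n, hs_norm w <= 1 & hs_norm (A *m v) = rdot (A *m v) w.
  have [Av0|N0] := eqVneq (hs_norm (A *m v)) 0.
    exists 0; first by rewrite hs_norm0.
    by rewrite (hs_norm_eq0 Av0) -hs_norm_sqr !hs_norm0 expr0n.
  exists (((hs_norm (A *m v))^-1)%:C%C *: (A *m v)).
    by rewrite hs_normZ ger0_norm ?invr_ge0 ?hs_norm_ge0 // mulVf.
  by rewrite rdotC rdotZl -hs_norm_sqr expr2 mulrA mulVf ?mul1r.
have [f hf fv] := net_vec_approx n0 v1; have [g hg gw] := net_vec_approx n0 w1.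
have -> : rdot (A *m v) w = rdot (A *m (v - net_vec f)) w
    + rdot (A *m net_vec f) (w - net_vec g) + rdot (A *m net_vec f) (net_vec g).
  rewrite -addrA [X in _ + X](_ : _ = rdot (A *m net_vec f) w); last first.
    by rewrite ![rdot (A *m net_vec f) _]rdotC -rdotDl subrK.
  by rewrite -rdotDl mulmxBr subrK.
have := bM _ _ _ _ fv w1; have := bM _ _ _ _ (hs_norm_net_vec hf) gw; have := hB _ _ hf hg.
lra.
Qed.

End NetOperatorNorm.

(** * Medians and centering *)

Section Measurability.
Context {R : realType} {dT : measure_display} {T : measurableType dT}.
Implicit Types (f : T -> R) (a : R).

Lemma measurable_sublevel f a : measurable_fun setT f -> measurable [set w | f w <= a].
Proof.
move=> mf; rewrite (_ : [set _ | _] = setT `&` f @^-1` `]-oo, a]); first exact: mf.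
by apply/seteqP; split => w /=; rewrite in_itv /= => // -[].
Qed.

Lemma measurable_suplevel f a : measurable_fun setT f -> measurable [set w | a <= f w].
Proof.
move=> mf; rewrite (_ : [set _ | _] = setT `&` f @^-1` `[a, +oo[); first exact: mf.
by apply/seteqP; split => w /=; rewrite in_itv /= andbT => // -[].
Qed.

Lemma measurable_deviation f a t :
  measurable_fun setT f -> measurable [set w | t <= `|f w - a|].
Proof.
move=> mf; apply: (@measurable_suplevel (fun w => `|f w - a|)).
by apply: measurableT_comp => //; exact: measurable_funB.
Qed.

(* The composite is an infimum, over rational points q, of H q + |X - q|_1. *)
Lemma lipschitz_measurable (I : finType) (X : T -> I -> R) (H : (I -> R) -> R) :
  (forall i, measurable_fun setT (X ^~ i)) ->
  (forall x y, `|H x - H y| <= \sum_i `|x i - y i|) ->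
  measurable_fun setT (fun w => H (X w)).
Proof.
move=> mX lipH mD.
apply: (measurability _ (RGenInftyO.measurableE R)) => //.
move=> _ [_ [a ->] <-]; rewrite setTI.
pose pt (q : {ffun I -> rat}) : I -> R := fun i => ratr (q i).
rewrite (_ : _ @^-1` _ = \bigcup_(q : {ffun I -> rat})
   (setT `&` (fun w => H (pt q) + \sum_i `|X w i - pt q i|) @^-1` `]-oo, a[)).
  apply: countable_bigcupT_measurable; first exact: countableP.
  move=> q; suff mq : measurable_fun setT (fun w => H (pt q) + \sum_i `|X w i - pt q i|).
    by apply: mq.
  apply: measurable_funD => //; apply: measurable_sum => i.
  by apply: measurableT_comp => //; exact: measurable_funB.
apply/seteqP; split => [w /= | w [q _] [_] /=]; rewrite !in_itv /=; last first.
  apply: le_lt_trans; rewrite -lerBlDl.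
  by apply: le_trans (lipH _ _); exact: ler_norm.
(* Rounding each coordinate within [e] costs at most [2 |I| e], half in [H] and half in the l1
   distance; this stays below the gap [a - H (X w)]. The successor keeps the denominator nonzero
   when [I] is empty. *)
move=> Ha; pose e := (a - H (X w)) / (2 * #|I|.+1%:R).
have e0 : 0 < e by rewrite divr_gt0 ?subr_gt0 // mulr_gt0.
have ex i : exists q : rat, `|X w i - ratr q| < e.
  have lt : X w i < X w i + e by rewrite ltrDl.
  have [q /itvP qe] := rat_in_itvoo lt.
  by exists q; rewrite distrC ger0_norm ?subr_ge0 ?qe // ltrBlDl qe.
pose q := [ffun i => projT1 (cid (ex i))].
exists q => //; split => //; rewrite /= in_itv /=.
have hq i : `|X w i - pt q i| <= e.
  by rewrite /pt ffunE; apply: ltW; exact: (projT2 (cid (ex i))).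
have s1 : \sum_i `|X w i - pt q i| <= #|I|%:R * e.
  apply: (@le_trans _ _ (\sum_(i : I) e)); first exact: ler_sum.
  by rewrite sumr_const mulr_natl.
have s2 : H (pt q) - H (X w) <= \sum_i `|X w i - pt q i|.
  by apply: le_trans (lipH _ _); rewrite distrC ler_norm.
have s3 : #|I|%:R * e * 2 < a - H (X w).
  rewrite /e; have N0 : (0 : R) <= #|I|%:R by [].
  rewrite -natr1; set N := #|I|%:R in N0 *.
  rewrite mulrA -mulrAC ltr_pdivrMr; last by nra.
  have : 0 < a - H (X w) by rewrite subr_gt0.
  nra.
lra.
Qed.

End Measurability.

Section Probability.
Context {R : realType} {dT : measure_display} {T : measurableType dT}.
Variable P : probability T R.
Implicit Types (Z : T -> R).

Lemma probability_union_le (I : finType) (p : pred I) (A : I -> set T) (B : set T) :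
  (forall i, measurable (A i)) -> measurable B ->
  (forall w, B w -> exists2 i, p i & A i w) ->
  (P B <= \sum_(i | p i) P (A i))%E.
Proof.
move=> mA mB hB; pose U := \big[setU/set0]_(i | p i) A i.
have mU : measurable U by exact: bigsetU_measurable.
apply: (@le_trans _ _ (P U)).
  apply: le_measure; rewrite ?inE // => w /hB [i pi Aiw].
  by rewrite /U (bigD1 i) //=; left.
suff [] : measurable U /\ (P U <= \sum_(i | p i) P (A i))%E by [].
rewrite /U; elim/big_rec2: _ => [|i x V pi [mV hV]].
  by split; [exact: measurable0 | rewrite measure0].
split; first exact: measurableU.
by apply: le_trans (measureU2 _ _ _) _ => //; rewrite leeD2l.
Qed.

(** The lower quantile works: the infimum of the points where the distribution function reaches 1/2.
    The limits at infinity make the infimum meaningful, and right-continuity gives the first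
    inequality. Concentration is stated around a given median, so one has to be supplied. *)
Lemma median_exists Z : measurable_fun setT Z -> exists m, is_median P Z m.
Proof.
move=> mZ.
have half : 1 - 2^-1 = 2^-1 :> R by lra.
pose X : {RV P >-> R} := HB.pack Z (isMeasurableFun.Build _ _ _ _ Z mZ).
pose E := [set a : R | ((2^-1)%:E <= cdf X a)%E].
have cdfE a : cdf X a = P [set w | (Z w <= a)%R].
  by congr (P _); apply/seteqP; split => w /=; rewrite in_itv.
have h01 : ((2^-1)%:E < 1 :> \bar R)%E by rewrite lte_fin; lra.
have h0 : (0 < (2^-1)%:E :> \bar R)%E by rewrite lte_fin.
have Ene : E !=set0.
  apply/set0P/negP => /eqP E0; move: h01; rewrite ltNge => /negP; apply.
  apply: cvge_le (cvg_cdfy1 X); near=> a; apply: ltW; rewrite ltNge; apply/negP => ha.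
  by have : E a by []; rewrite E0.
have Elb : has_lbound E.
  apply: contrapT => nlb; move: h0; rewrite ltNge => /negP; apply.
  apply: cvge_ge (cvg_cdfNy0 X); near=> a.
  have [b Eb ba] : exists2 b, E b & b < a.
    apply: contrapT => nb; apply: nlb; exists a => b Eb; rewrite leNgt; apply/negP => ba.
    by apply: nb; exists b.
  by apply: le_trans Eb _; apply: cdf_nondecreasing; exact: ltW.
exists (inf E); split.
  rewrite -cdfE; apply: cvge_ge (@cdf_right_continuous _ _ _ _ X (inf E)); near=> a.
  have : inf E < a by near: a; exact: nbhs_right_gt.
  move=> /(inf_lt Ene) [b Eb ba].
  by apply: le_trans Eb _; apply: cdf_nondecreasing; exact: ltW.
(* The event [Z < inf E] is the increasing union of the [F k], each of probability below 1/2;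
   continuity from below gives the second inequality. *)
pose F k := [set w | (Z w <= inf E - k.+1%:R^-1)%R].
have mF k : measurable (F k) by exact: measurable_sublevel.
have mUF : measurable (\bigcup_k F k) by exact: bigcup_measurable.
have UF : \bigcup_k F k = ~` [set w | (inf E <= Z w)%R].
  apply/seteqP; split => [w [k _] /= hk /= hZ | w /= /negP].
    have k0 : (0 : R) < k.+1%:R^-1 by rewrite invr_gt0.
    by have := le_trans hZ hk; rewrite leNgt gtrBl k0.
  rewrite -ltNge => hZ; have d0 : 0 < inf E - Z w by rewrite subr_gt0.
  exists (Num.truncn (inf E - Z w)^-1) => //=.
  rewrite /F /= lerBrDl -lerBrDr -[leRHS]invrK lef_pV2 ?posrE ?invr_gt0 ?ltr0n //.
  by apply: ltW; exact: truncnS_gt.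
have PF : (P (\bigcup_k F k) <= (2^-1)%:E)%E.
  apply: cvge_le (nondecreasing_cvg_mu mF mUF _) => //; last first.
    move=> k l kl; apply/subsetPset => w /= hk; apply: le_trans hk _.
    by rewrite lerD2l lerN2 lef_pV2 ?posrE // ler_nat.
  near=> k; rewrite /= -cdfE; apply: ltW; rewrite ltNge; apply/negP => hk.
  have k0 : (0 : R) < k.+1%:R^-1 by rewrite invr_gt0.
  by have := ge_inf Elb hk; rewrite leNgt gtrBl k0.
move: PF; rewrite UF probability_setC; last exact: measurable_suplevel.
rewrite leeBlDr ?fin_num_measure //; last exact: measurable_suplevel.
by rewrite -leeBlDl // -EFinB half.
Unshelve. all: by end_near.
Qed.

(** Centering gives [|m| = |E(Z - m)| <= E|Z - m|], which is at most [rho] times the sum over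
    [k >= 0] of [P(|Z - m| >= k rho)], a series dominated by a geometric one of total 4. *)
Lemma centered_median Z m rho : 0 < rho ->
  P.-integrable setT (EFin \o Z) -> (\int[P]_w (Z w)%:E = 0)%E ->
  (forall t, 0 < t ->
     (P [set w | (t <= `|Z w - m|)%R] <= (2 * expR (- t ^+ 2 / rho ^+ 2))%:E)%E) ->
  `|m| <= 4 * rho.
Proof.
have half : 4 / 2 = 2 :> R by lra.
move=> rho0 iZ EZ hZ.
have mZ : measurable_fun setT Z by apply/measurable_EFinP; exact: (measurable_int P).
pose A k := [set w | (k%:R * rho <= `|Z w - m|)%R].
have mA k : measurable (A k) by exact: measurable_deviation.
(* For [k = 0] the bound is 2, hence trivial; afterwards [exp(-k^2) <= exp(-k) <= 2^-k]. The shape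
   [4 / 2^(k+1)] is the one summed by [epsilon_trick0]. *)
have PA k : (P (A k) <= (4 / (2 ^ k.+1)%:R)%:E)%E.
  case: k => [|k].
    by apply: le_trans (probability_le1 _ (mA _)) _; rewrite lee_fin half ler1n.
  apply: le_trans (hZ _ _) _; first by rewrite mulr_gt0.
  rewrite lee_fin.
  have -> : 4 / (2 ^ k.+2)%:R = 2 / 2 ^+ k.+1 :> R by rewrite natrX exprS invfM mulrA half.
  rewrite ler_pM2l // exprMn -mulNr mulfK ?expf_neq0 ?gt_eqF //.
  rewrite expRN lef_pV2 ?posrE ?expR_gt0 ?exprn_gt0 //.
  apply: (@le_trans _ _ (expR k.+1%:R)); last first.
    by rewrite ler_expR expr2 ler_peMr // ler1n.
  rewrite -[k.+1%:R]mulr1 expRM_natl; apply: lerXn2r; rewrite ?nnegrE ?expR_ge0 //.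
  by apply: le_trans (expR_ge1Dx 1).
(* [g] is [rho] times the number of [k] with [k rho <= |Z - m|], that is, the integer part of
   [|Z - m| / rho] plus one; hence it dominates [|Z - m|]. *)
pose g w : \bar R := (\sum_(0 <= k <oo) (rho%:E * (\1_(A k) w)%:E))%E.
have g0 k w : (0 <= rho%:E * (\1_(A k) w)%:E)%E.
  by rewrite mule_ge0 // lee_fin // ltW.
have mg k : measurable_fun setT (fun w => rho%:E * (\1_(A k) w)%:E)%E.
  apply: measurable_funeM; apply/measurable_EFinP; exact: measurable_indic.
have Zg w : (`|(Z w - m)%:E| <= g w)%E.
  set N := (Num.truncn (`|Z w - m| / rho)).+1.
  apply: (@le_trans _ _ (\sum_(0 <= k < N) (rho%:E * (\1_(A k) w)%:E))%E); last first.
    by apply: nneseries_lim_ge => k _ _; exact: g0.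
  rewrite (eq_big_nat _ _ (F2 := fun=> rho%:E)); last first.
    move=> k /andP[_ kN]; rewrite indicE mem_set ?mule1 //= /A /=.
    rewrite -ler_pdivlMr //; move: kN; rewrite ltnS => kN.
    apply: (@le_trans _ _ (Num.truncn (`|Z w - m| / rho))%:R); first by rewrite ler_nat.
    by rewrite truncn_le divr_ge0 // ltW.
  rewrite sumEFin big_const_nat subn0 iter_addr_0 abse_EFin lee_fin.
  by rewrite -mulr_natl -ler_pdivrMr //; apply/ltW/truncnS_gt.
have mZm : measurable_fun setT (fun w => (Z w - m)%:E).
  by apply/measurable_EFinP; exact: measurable_funB.
have le1 : (\int[P]_w `|(Z w - m)%:E| <= (4 * rho)%:E)%E.
  apply: (@le_trans _ _ (\int[P]_w g w)%E).
    apply: ge0_le_integral => //.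
    - exact: measurableT_comp.
    - by apply: ge0_emeasurable_sum => k *; [exact: g0|exact: mg].
  rewrite integral_nneseries //.
  apply: le_trans (epsilon_trick0 xpredT _); last by rewrite mulr_ge0 // ltW.
  apply: lee_nneseries => [k _ _|k _]; first by apply: integral_ge0.
  rewrite ge0_integralZl_EFin ?(ltW rho0) //; last by apply/measurable_EFinP; exact: measurable_indic.
  rewrite integral_indic // setIT [4 * rho]mulrC -mulrA EFinM.
  by rewrite lee_pmul2l ?lte_fin //; exact: PA.
have Em : (\int[P]_w (Z w - m)%:E = (- m)%:E)%E.
  rewrite integralB_EFin //; last exact: finite_measure_integrable_cst.
  rewrite EZ integral_cst //.
  by rewrite [X in (_ * X)%E](probability_setT P) mule1 sub0e.
by rewrite -lee_fin -normrN -abse_EFin -Em; apply: le_trans (le_abse_integral _ _ _) le1.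
Qed.

End Probability.

(** * Lipschitz functions of random matrices *)

(** McShane's formula: [G x] is the infimum of [f s + D x s] over [s] in [S]. *)
Lemma lipschitz_extension {R : realType} (V : Type) (D : V -> V -> R) (S : set V) (f : V -> R) :
  (forall x y, D x y = D y x) -> (forall x, D x x = 0) ->
  (forall x y z, D x z <= D x y + D y z) -> S !=set0 ->
  (forall x y, S x -> S y -> `|f x - f y| <= D x y) ->
  exists2 G : V -> R, (forall x, S x -> G x = f x) & (forall x y, `|G x - G y| <= D x y).
Proof.
move=> Dsym D0 Dtri [s0 Ss0] lipf.
pose E x := [set f s + D x s | s in S].
(* This bound makes the infimum finite and, with [z = x], gives [f x <= G x] on [S]. *)
have Elb x z : S z -> lbound (E x) (f z - D x z).
  move=> Sz _ [s Ss <-]; have := Dtri s x z; rewrite (Dsym s x) => h.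
  have := lipf _ _ Sz Ss; rewrite ler_norml => /andP[_]; rewrite (Dsym z s); lra.
have Ene x : E x !=set0 by exists (f s0 + D x s0), s0.
have Einf x : has_lbound (E x) by exists (f s0 - D x s0); exact: Elb.
have half x y : inf (E x) - inf (E y) <= D x y.
  rewrite lerBlDr -lerBlDl; apply: lb_le_inf => // _ [s Ss <-].
  rewrite lerBlDl; apply: (@le_trans _ _ (f s + D x s)); last by have := Dtri x y s; lra.
  by apply: ge_inf => //; exists s.
exists (fun x => inf (E x)) => [x Sx|x y].
  apply/eqP; rewrite eq_le; apply/andP; split.
    by apply: ge_inf => //; exists x => //; rewrite D0 addr0.
  by apply: lb_le_inf => //; have := Elb x x Sx; rewrite D0 subr0.
by rewrite ler_norml half lerNl opprB Dsym half.
Qed.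

Section TupleDistance.
Context {R : realType} {n L : nat}.
Local Notation C := (complex R).
Implicit Types x y z : 'I_L -> 'M[C]_n.

Lemma ler_l2norm (I : finType) (f g : I -> R) :
  (forall i, 0 <= f i <= g i) -> l2norm f <= l2norm g.
Proof.
move=> fg; rewrite ler_wsqrtr // ler_sum // => i _.
by have /andP[f0 fgi] := fg i; rewrite ler_pXn2r ?nnegrE // (le_trans f0).
Qed.

Lemma tuple_distE x y : tuple_dist x y = l2norm (fun l => hs_norm (x l - y l)).
Proof.
congr Num.sqrt; apply: eq_bigr => l _; rewrite hs_norm_sqrE.
by apply: eq_bigr => a _; apply: eq_bigr => b _; rewrite !mxE.
Qed.

Lemma hs_norm_distC m p (A B : 'M[C]_(m, p)) : hs_norm (A - B) = hs_norm (B - A).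
Proof. by rewrite -opprB hs_normN. Qed.

Lemma tuple_distC x y : tuple_dist x y = tuple_dist y x.
Proof. by rewrite !tuple_distE; apply: eq_l2norm => l; rewrite hs_norm_distC. Qed.

Lemma tuple_distxx x : tuple_dist x x = 0.
Proof.
rewrite tuple_distE /l2norm big1 ?sqrtr0 // => l _.
by rewrite subrr hs_norm0 expr0n.
Qed.

Lemma tuple_dist_triangle x y z : tuple_dist x z <= tuple_dist x y + tuple_dist y z.
Proof.
rewrite !tuple_distE; apply: le_trans (l2norm_triangle _ _).
apply: ler_l2norm => l; rewrite hs_norm_ge0 /=.
have -> : x l - z l = (x l - y l) + (y l - z l) by rewrite addrA subrK.
exact: hs_normD.
Qed.

Lemma hs_norm_le_tuple_dist x y l : hs_norm (x l - y l) <= tuple_dist x y.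
Proof.
rewrite tuple_distE; apply: le_trans (coord_le_l2norm _ l).
exact: ler_norm.
Qed.

(** Real coordinates on tuples of matrices, through which [lipschitz_measurable] is transported. *)
Definition tuple_of_coords (c : 'I_L * ('I_n * 'I_n * bool) -> R) : 'I_L -> 'M[C]_n :=
  fun l => \matrix_(a, b) Complex (c (l, (a, b, false))) (c (l, (a, b, true))).

Lemma mxcoord_tuple_of_coords c l k : mxcoord (tuple_of_coords c l) k = c (l, k).
Proof. by case: k => [[a b] []]; rewrite /mxcoord mxE. Qed.

Lemma tuple_of_coordsK x : tuple_of_coords (fun k => mxcoord (x k.1) k.2) = x.
Proof.
apply/funext => l; apply/matrixP => a b; rewrite mxE /mxcoord /=.
by case: (x l a b).
Qed.

Lemma tuple_dist_coords c c' :
  tuple_dist (tuple_of_coords c) (tuple_of_coords c') <= \sum_k `|c k - c' k|.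
Proof.
rewrite tuple_distE; apply: le_trans (l2norm_le_sum _) _.
rewrite [leRHS](_ : _ = \sum_l \sum_k `|c (l, k) - c' (l, k)|); last first.
  by rewrite pair_bigA; apply: eq_bigr => -[].
apply: ler_sum => l _; rewrite ger0_norm ?hs_norm_ge0 // hs_normE.
apply: le_trans (l2norm_le_sum _) _; apply: ler_sum => k _.
rewrite -!(mxcoord_tuple_of_coords _ l).
by rewrite /mxcoord !mxE ccoordD ccoordN.
Qed.

End TupleDistance.

(** * Measurability of random matrices and of their Lipschitz images *)

Section RandomMatrices.
Context {R : realType} {dT : measure_display} {T : measurableType dT}.
Local Notation C := (complex R).

Definition cmeasurable (f : T -> C) :=
  measurable_fun setT (fun w => complex.Re (f w)) /\
  measurable_fun setT (fun w => complex.Im (f w)).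

Lemma cmeasurable_cst c : cmeasurable (fun=> c).
Proof. by split; exact: measurable_cst. Qed.

Lemma cmeasurableD f g :
  cmeasurable f -> cmeasurable g -> cmeasurable (fun w => f w + g w).
Proof.
move=> [f1 f2] [g1 g2]; split.
  rewrite (_ : (fun _ => _) = fun w => complex.Re (f w) + complex.Re (g w)).
    exact: measurable_funD.
  by apply/funext => w; case: (f w) (g w) => [? ?] [].
rewrite (_ : (fun _ => _) = fun w => complex.Im (f w) + complex.Im (g w)).
  exact: measurable_funD.
by apply/funext => w; case: (f w) (g w) => [? ?] [].
Qed.

Lemma cmeasurableM f g :
  cmeasurable f -> cmeasurable g -> cmeasurable (fun w => f w * g w).
Proof.
move=> [f1 f2] [g1 g2]; split.
  rewrite (_ : (fun _ => _) = fun w => complex.Re (f w) * complex.Re (g w)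
      - complex.Im (f w) * complex.Im (g w)).
    by apply: measurable_funB; exact: measurable_funM.
  by apply/funext => w; case: (f w) (g w) => [? ?] [].
rewrite (_ : (fun _ => _) = fun w => complex.Re (f w) * complex.Im (g w)
    + complex.Im (f w) * complex.Re (g w)).
  by apply: measurable_funD; exact: measurable_funM.
by apply/funext => w; case: (f w) (g w) => [? ?] [].
Qed.

Lemma cmeasurableJ f : cmeasurable f -> cmeasurable (fun w => conjc (f w)).
Proof.
move=> [f1 f2]; split.
  by rewrite (_ : (fun _ => _) = fun w => complex.Re (f w)) //; apply/funext => w; case: (f w).
rewrite (_ : (fun _ => _) = fun w => - complex.Im (f w)).
  exact: measurableT_comp.
by apply/funext => w; case: (f w).
Qed.

Lemma cmeasurable_sum I (s : seq I) (p : pred I) (f : I -> T -> C) :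
  (forall i, cmeasurable (f i)) -> cmeasurable (fun w => \sum_(i <- s | p i) f i w).
Proof.
move=> mf; elim: s => [|i s IH].
  rewrite (_ : (fun _ => _) = fun=> 0); first exact: cmeasurable_cst.
  by apply/funext => w; rewrite big_nil.
case pi : (p i).
  rewrite (_ : (fun _ => _) = fun w => f i w + \sum_(j <- s | p j) f j w).
    exact: cmeasurableD.
  by apply/funext => w; rewrite big_cons pi.
rewrite (_ : (fun _ => _) = fun w => \sum_(j <- s | p j) f j w) //.
by apply/funext => w; rewrite big_cons pi.
Qed.

Definition mx_measurable m p (Y : T -> 'M[C]_(m, p)) :=
  forall i j, cmeasurable (fun w => Y w i j).

Lemma mx_measurable_cst m p (A : 'M[C]_(m, p)) : mx_measurable (fun=> A).
Proof. by move=> i j; exact: cmeasurable_cst. Qed.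

Lemma mx_measurable_mul m p q (Y : T -> 'M[C]_(m, p)) (Z : T -> 'M[C]_(p, q)) :
  mx_measurable Y -> mx_measurable Z -> mx_measurable (fun w => Y w *m Z w).
Proof.
move=> mY mZ i j; under eq_fun do rewrite mxE.
by apply: cmeasurable_sum => k; exact: cmeasurableM.
Qed.

Lemma mx_measurable_sum m p I (s : seq I) (f : I -> T -> 'M[C]_(m, p)) :
  (forall i, mx_measurable (f i)) -> mx_measurable (fun w => \sum_(i <- s) f i w).
Proof.
move=> mf i j; under eq_fun do rewrite summxE.
by apply: cmeasurable_sum => k; exact: mf.
Qed.

Lemma mx_measurable_poly n L d (A : nc_coeffs R n L d) (x : T -> 'I_L -> 'M[C]_n) :
  (forall l, mx_measurable (fun w => x w l)) -> mx_measurable (fun w => nc_poly A (x w)).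
Proof.
move=> mx; rewrite /nc_poly.
apply: mx_measurable_sum => k; apply: mx_measurable_sum => ii; apply: mx_measurable_sum => eps.
apply: mx_measurable_mul; first exact: mx_measurable_cst.
elim: (index_enum _) => [|j s IH].
  under eq_fun do rewrite big_nil; exact: mx_measurable_cst.
under eq_fun do rewrite big_cons; apply: mx_measurable_mul => //.
apply: mx_measurable_mul; last exact: mx_measurable_cst.
rewrite /mxpow; case: (eps j) => // a b; under eq_fun do rewrite mxE.
have h := cmeasurableJ (mx (ii j) b a); exact: h.
Qed.

Lemma mx_measurable_coord m p (Y : T -> 'M[C]_(m, p)) k :
  mx_measurable Y -> measurable_fun setT (fun w => mxcoord (Y w) k).
Proof. by move=> mY; case: k => [[i j] b]; have [m1 m2] := mY i j; case: b. Qed.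

Lemma mx_measurable_scale m p (z : C) (Y : T -> 'M[C]_(m, p)) :
  mx_measurable Y -> mx_measurable (fun w => z *: Y w).
Proof.
move=> mY i j; under eq_fun do rewrite mxE.
by have h := cmeasurableM (cmeasurable_cst z) (mY i j); exact: h.
Qed.

Lemma tuple_lipschitz_measurable n L (X : T -> 'I_L -> 'M[C]_n)
    (G : ('I_L -> 'M[C]_n) -> R) :
  (forall l, mx_measurable (fun w => X w l)) ->
  (forall x y, `|G x - G y| <= tuple_dist x y) ->
  measurable_fun setT (fun w => G (X w)).
Proof.
move=> mX lipG.
have := @lipschitz_measurable R dT T _
  (fun w k => mxcoord (X w k.1) k.2) (fun c => G (tuple_of_coords c)).
under [X in _ -> _ -> measurable_fun _ X]eq_fun do rewrite tuple_of_coordsK.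
apply => [k|c c']; first exact: mx_measurable_coord.
by apply: le_trans (lipG _ _) _; exact: tuple_dist_coords.
Qed.

Lemma hs_lipschitz_measurable n (Y : T -> 'M[C]_n) (F : 'M[C]_n -> R) :
  mx_measurable Y -> (forall x y, `|F x - F y| <= hs_norm (x - y)) ->
  measurable_fun setT (fun w => F (Y w)).
Proof.
move=> mY lipF.
apply: (@tuple_lipschitz_measurable n 1 (fun w _ => Y w) (fun x => F (x ord0))) => //.
move=> x y; apply: le_trans (lipF _ _) _; exact: hs_norm_le_tuple_dist.
Qed.

End RandomMatrices.

(** * Concentration of polynomials *)

Section Concentration.
Context {R : realType} {dT : measure_display} {T : measurableType dT}.
Local Notation C := (complex R).
Variable P : probability T R.

(** If [m] were at distance at least [s] from [a], the half-line from [m] pointing away from [a]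
    would lie in the deviation event, yet it has probability at least 1/2. *)
Lemma median_close (Z : T -> R) a m s : measurable_fun setT Z -> is_median P Z m ->
  (P [set w | (s <= `|Z w - a|)%R] < (2^-1)%:E)%E -> `|m - a| < s.
Proof.
move=> mZ [m1 m2] small; rewrite ltNge; apply/negP => far.
have mdev := measurable_deviation a s mZ.
move: small; rewrite ltNge => /negP; apply.
have [ma|am] := leP m a.
  apply: le_trans m1 _; apply: le_measure; rewrite ?inE //.
    exact: measurable_sublevel.
  move=> w /= hw; apply: le_trans far _.
  have Za : Z w <= a by apply: le_trans ma.
  rewrite !ler0_norm ?subr_le0 //; lra.
apply: le_trans m2 _; apply: le_measure; rewrite ?inE //.
  exact: measurable_suplevel.
move=> w /= hw; apply: le_trans far _.
have aZ : a <= Z w by apply: le_trans hw; exact: ltW.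
by rewrite !ger0_norm ?subr_ge0 ?(ltW am) // lerD2r.
Qed.

Variables (n L : nat) (X : T -> 'I_L -> 'M[C]_n) (rho : R).
Hypothesis n0 : (0 < n)%N.
Hypothesis rho0 : 0 < rho.
Hypothesis mX : forall l, mx_measurable (fun w => X w l).
Hypothesis cX : forall l k, P.-integrable setT (fun w => (mxcoord (X w l) k)%:E) /\
   (\int[P]_w (mxcoord (X w l) k)%:E = 0)%E.
Hypothesis concX : subgauss_conc P X rho.

Lemma bilinear_lipschitz l (u v : 'cV[C]_n) (x y : 'I_L -> 'M[C]_n) :
  hs_norm u <= 1 -> hs_norm v <= 1 ->
  `|rdot (x l *m u) v - rdot (y l *m u) v| <= tuple_dist x y.
Proof.
move=> u1 v1.
suff half x' y' : rdot (x' l *m u) v - rdot (y' l *m u) v <= tuple_dist x' y'.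
  by rewrite ler_norml half lerNl opprB tuple_distC half.
rewrite -rdotNl -rdotDl -mulmxBl; apply: le_trans (hs_norm_le_tuple_dist _ _ l).
apply: le_trans (rdot_le _ _) _.
rewrite -[leRHS]mulr1 ler_pM ?hs_norm_ge0 //.
by apply: le_trans (hs_norm_mulv _ _) _; rewrite ler_piMr ?hs_norm_ge0.
Qed.

(** The form is linear in the entries of [X l], hence centered, so its median is at most
    [4 * rho <= s / 2]; reaching [s] forces a deviation of [s / 2] from the median. *)
Lemma bilinear_tail l (u v : 'cV[C]_n) s :
  hs_norm u <= 1 -> hs_norm v <= 1 -> 8 * rho <= s ->
  (P [set w | (s <= rdot (X w l *m u) v)%R] <= (2 * expR (- (s / 2) ^+ 2 / rho ^+ 2))%:E)%E.
Proof.
move=> u1 v1 hs.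
pose Z w : R := rdot (X w l *m u) v.
have lipH x y := bilinear_lipschitz l x y u1 v1.
have mZ : measurable_fun setT Z.
  exact: (tuple_lipschitz_measurable (G := fun x => rdot (x l *m u) v)).
have [m hm] := median_exists P mZ.
have hconc t : 0 < t -> (P [set w | (t <= `|Z w - m|)%R] <= (2 * expR (- t ^+ 2 / rho ^+ 2))%:E)%E.
  by move=> t0; apply: (concX lipH t0 hm).
pose c k := mxcoord (v *m adjmx u) k.
have ZE w : Z w = \sum_k c k * mxcoord (X w l) k.
  by rewrite /Z rdot_mulr; apply: eq_bigr => k _; rewrite mulrC.
have iZk k : P.-integrable setT (fun w => ((c k)%:E * (mxcoord (X w l) k)%:E)%E).
  by apply: integrableZl => //; case: (cX l k).
have EZ : EFin \o Z = (fun w => \sum_k ((c k)%:E * (mxcoord (X w l) k)%:E))%E.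
  by apply/funext => w /=; rewrite ZE -sumEFin.
have m4 : `|m| <= 4 * rho.
  apply: (centered_median rho0 _ _ hconc); first by rewrite EZ; exact: integrable_sum.
  rewrite -[LHS]/(\int[P]_w ((EFin \o Z) w))%E EZ integral_sum // big1 // => k _.
  by rewrite integralZl //; [case: (cX l k) => _ ->; rewrite mule0 | case: (cX l k)].
have s0 : 0 < s by apply: lt_le_trans hs; rewrite mulr_gt0.
apply: le_trans (hconc (s / 2) _); last by rewrite divr_gt0.
apply: le_measure; rewrite ?inE.
- exact: measurable_suplevel.
- exact: measurable_deviation.
move=> w /=; rewrite -/(Z w) => hw.
apply: le_trans (ler_norm _); move: m4; rewrite ler_norml; lra.
Qed.

(** The first exponential comes from the McShane extension, the second from the net. In
    [1 + 48 * rho] the 1 ensures [1 <= kappa], and the 48 lets the tail beat the size of the net. *)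
Lemma truncated_deviation d (A : nc_coeffs R n L d) (F : 'M[C]_n -> R) (kappa s : R) :
  (forall k ii eps j, op_norm (A k ii eps j) <= 1) ->
  (forall x y, `|F x - F y| <= hs_norm (x - y)) ->
  1 + 48 * rho <= kappa -> 0 < s ->
  let Y w := nc_poly A (fun l => (((Num.sqrt (n%:R : R))^-1)%:C)%C *: X w l) in
  exists a : R,
   (P [set w | (s <= `|F (Y w) - a|)%R] <=
     (2 * expR (- (s ^+ 2 * n%:R) / ((poly_lip L d + 1) ^+ 2 * kappa ^+ d.-1 ^+ 2 * rho ^+ 2))
      + 2 * L%:R * expR (- (kappa ^+ 2 * n%:R) / (32 * rho ^+ 2)))%:E)%E.
Proof.
move=> A1 lipF hk s0 Y; set rn : R := Num.sqrt n%:R in Y *.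
have n0r : (0 : R) < n%:R by rewrite ltr0n.
have rn0 : 0 < rn by rewrite sqrtr_gt0.
have rn2 : rn ^+ 2 = n%:R by rewrite sqr_sqrtr.
have k1 : 1 <= kappa by apply: le_trans hk; rewrite lerDl mulr_ge0 // ltW.
have k0 : 0 < kappa by apply: lt_le_trans k1.
have hs8 : 8 * rho <= kappa * rn / 2.
  have rn1 : 1 <= rn by rewrite -[leLHS]sqrtr1 ler_wsqrtr // ler1n.
  have : kappa <= kappa * rn by rewrite ler_peMr // ltW.
  have := rho0; lra.
(* [48^2 / 16 = 144] is twice the 72 in [exp(72 n)], the bound on the number of pairs of net
   vectors. *)
have hk2 : 144 * n%:R <= (kappa ^+ 2 * n%:R) / (16 * rho ^+ 2).
  rewrite ler_pdivlMr ?mulr_gt0 ?exprn_gt0 //.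
  rewrite (_ : 144 * n%:R * (16 * rho ^+ 2) = (48 * rho) ^+ 2 * n%:R); last by ring.
  rewrite ler_pM2r // lerXn2r ?nnegrE ?mulr_ge0 ?ltW //; lra.
set K := poly_lip L d + 1.
have K0 : 0 < K by rewrite ltr_wpDl // poly_lip_ge0.
(* [lam] bounds the Lipschitz constant on [S] of [F] composed with the scaled polynomial; the 1
   added in [K] keeps it positive, so that [f] can be divided by it. *)
pose lam := K * kappa ^+ d.-1 / rn.
have lam0 : 0 < lam by rewrite divr_gt0 // mulr_gt0 // exprn_gt0.
pose S : set ('I_L -> 'M[C]_n) := [set x | forall l, op_norm (x l) <= kappa * rn].
pose sc (x : 'I_L -> 'M[C]_n) l := ((rn^-1)%:C)%C *: x l.
pose f x := lam^-1 * F (nc_poly A (sc x)).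
have Sop x l : S x -> op_bounded (sc x l) kappa.
  move=> Sx; rewrite (_ : kappa = rn^-1 * (kappa * rn)); last by rewrite mulrC mulfK // gt_eqF.
  apply: op_bounded_scale; first by rewrite invr_ge0 ltW.
  exact: op_bounded_le (Sx l) (op_norm_bounded _).
have lipf x y : S x -> S y -> `|f x - f y| <= tuple_dist x y.
  move=> Sx Sy; rewrite /f -mulrBr normrM gtr0_norm ?invr_gt0 //.
  rewrite ler_pdivrMl //; apply: le_trans (lipF _ _) _.
  apply: (@le_trans _ _ (poly_lip L d * kappa ^+ d.-1 * (rn^-1 * tuple_dist x y))).
    apply: hs_norm_polyB => //.
    - by rewrite mulr_ge0 ?invr_ge0 ?sqrtr_ge0.
    - by move=> k ii eps j; apply: op_bounded_le (A1 k ii eps j) _; exact: op_norm_bounded.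
    - by move=> l; exact: Sop.
    - by move=> l; exact: Sop.
    move=> l; rewrite /sc -scalerBr hs_normZ gtr0_norm ?invr_gt0 //.
    by rewrite ler_pM2l ?invr_gt0 // hs_norm_le_tuple_dist.
  rewrite /lam !mulrA ler_wpM2r ?sqrtr_ge0 // ler_wpM2r ?invr_ge0 ?sqrtr_ge0 //.
  by rewrite ler_wpM2r ?exprn_ge0 ?(ltW k0) // lerDl.
have Sne : S !=set0.
  exists (fun=> 0) => l /=; apply: op_norm_le => v _.
  by rewrite mul0mx hs_norm0 mulr_ge0 // ltW.
have [G GS lipG] := lipschitz_extension tuple_distC tuple_distxx tuple_dist_triangle Sne lipf.
have mG : measurable_fun setT (fun w => G (X w)) by exact: tuple_lipschitz_measurable.
have [a1 ha1] := median_exists P mG.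
have mFY : measurable_fun setT (fun w => F (Y w)).
  by apply: hs_lipschitz_measurable lipF; apply: mx_measurable_poly => l; exact: mx_measurable_scale.
exists (lam * a1).
pose J := ('I_n * bool)%type.
pose code := {ffun J -> bool * 'I_(16 * #|{: J}|).+1}.
(* Events of the union bound: one for the deviation of [G], and one for each matrix and pair of
   codes. Inadmissible codes get the empty event, so that every [E i] is measurable. *)
pose idx : finType := ('I_1 + 'I_L * (code * code))%type.
pose p (i : idx) := if i is inr j then net_code j.2.1 && net_code j.2.2 else true.
pose E (i : idx) : set T := if i is inr j then
   if net_code j.2.1 && net_code j.2.2 then
     [set w | (kappa * rn / 2 <= rdot (X w j.1 *m net_vec j.2.1) (net_vec j.2.2))%R]
   else set0
   else [set w | (s / lam <= `|G (X w) - a1|)%R].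
have mE i : measurable (E i).
  case: i => [_|[l [g h]]] /=; first exact: measurable_deviation.
  case: ifP => // /andP[hg hh]; apply: measurable_suplevel.
  apply: (tuple_lipschitz_measurable (G := fun x => rdot (x l *m net_vec g) (net_vec h))) => // x y.
  by apply: bilinear_lipschitz; exact: hs_norm_net_vec.
(* On [S] the deviation of [F (Y w)] is [lam] times that of [G]; off [S] some [op_norm] exceeds
   [kappa * rn], and [op_norm_net] yields a net pair above half of it. *)
have cover w : s <= `|F (Y w) - lam * a1| -> exists2 i, p i & E i w.
  move=> hw; have [SX|nS] := pselect (S (X w)).
    exists (inl ord0) => //=; rewrite GS // ler_pdivrMr //; apply: le_trans hw _.
    rewrite -[X in _ <= _ * X](gtr0_norm lam0) -normrM mulrBl /f.
    by rewrite [lam^-1 * _]mulrC divfK ?gt_eqF // [a1 * _]mulrC.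
  have [l hl] : exists l, kappa * rn < op_norm (X w l).
    apply: contrapT => hn; apply: nS => l; rewrite leNgt; apply/negP => hl.
    by apply: hn; exists l.
  apply: contrapT => hn; move: hl; rewrite ltNge => /negP; apply.
  rewrite (_ : kappa * rn = 2 * (kappa * rn / 2)); last by rewrite [RHS]mulrC divfK.
  apply: op_norm_net => // g h hg hh; rewrite leNgt; apply/negP => hgh; apply: hn.
  by exists (inr (l, (g, h))); rewrite /= hg hh //=; exact: ltW.
have := @probability_union_le _ _ _ P _ p E _ mE (measurable_deviation (lam * a1) s mFY) cover.
move=> h; apply: le_trans h _.
pose b (i : idx) : R := if i is inr _ then 2 * expR (- (kappa * rn / 2 / 2) ^+ 2 / rho ^+ 2)
  else 2 * expR (- (s / lam) ^+ 2 / rho ^+ 2).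
apply: (@le_trans _ _ (\sum_(i | p i) (b i)%:E)%E).
  apply: lee_sum => -[_ _|[l [g h]]] /=.
    by apply: (concX lipG) => //; rewrite divr_gt0.
  move=> /andP[hg hh]; rewrite hg hh /=; apply: bilinear_tail.
  - exact: hs_norm_net_vec.
  - exact: hs_norm_net_vec.
  exact: hs8.
rewrite sumEFin lee_fin big_sumType /= big_ord1_cond; apply: lerD.
  rewrite (_ : - (s / lam) ^+ 2 / rho ^+ 2 = - (s ^+ 2 * n%:R) /
    (K ^+ 2 * kappa ^+ d.-1 ^+ 2 * rho ^+ 2)) // -rn2 /lam.
  have := rho0; have := K0; have : 0 < kappa ^+ d.-1 by rewrite exprn_gt0.
  move: (kappa ^+ d.-1) rn0 => q rnp qp Kp rhop.
  by field; rewrite !gt_eqF.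
pose N : R := \sum_(g : code | net_code g) 1.
have N0 : 0 <= N by exact: sumr_ge0.
(* The net lives in [2n] real dimensions, so it has at most [2 ^+ (18 * 2n)] codes, and
   [2 <= exp 1]. *)
have NE : N <= expR (36 * n%:R).
  apply: le_trans count_net_code _.
  rewrite card_prod card_ord card_bool (_ : 18 * (n * 2) = 36 * n)%N; last by ring.
  rewrite (_ : 36 * n%:R = (36 * n)%N%:R * 1 :> R); last by rewrite mulr1 natrM.
  rewrite expRM_natl; apply: lerXn2r; rewrite ?nnegrE ?expR_ge0 //.
  by apply: le_trans (expR_ge1Dx 1).
set c := 2 * expR (- (kappa * rn / 2 / 2) ^+ 2 / rho ^+ 2).
have -> : \sum_(j : 'I_L * (code * code) | net_code j.2.1 && net_code j.2.2) c = L%:R * (N * N) * c.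
  rewrite -(pair_big xpredT (fun fg : code * code => net_code fg.1 && net_code fg.2)
    (fun _ _ => c)) /=.
  rewrite sumr_const card_ord -[LHS]mulr_natl -[RHS]mulrA; congr (_ * _).
  rewrite -(pair_big (@net_code _) (@net_code _) (fun _ _ => c)) /=.
  rewrite /N -mulrA mulr_suml; apply: eq_bigr => f' _.
  by rewrite mul1r mulr_suml; apply: eq_bigr => g' _; rewrite mul1r.
set e := expR (- (kappa ^+ 2 * n%:R) / (32 * rho ^+ 2)).
rewrite [2 * L%:R]mulrC -!mulrA ler_wpM2l // [N * _]mulrA /c mulrCA ler_pM2l //.
apply: (@le_trans _ _ (expR (36 * n%:R) * expR (36 * n%:R) *
    expR (- (kappa * rn / 2 / 2) ^+ 2 / rho ^+ 2))).
  by rewrite ler_wpM2r ?expR_ge0 // ler_pM.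
(* With [x = kappa^2 n / (16 rho^2)] the exponent on the left is [72 n - x], at most [- x / 2] by
   [hk2]. *)
rewrite /e -!expRD ler_expR.
rewrite (_ : - (kappa * rn / 2 / 2) ^+ 2 / rho ^+ 2 =
   - ((kappa ^+ 2 * n%:R) / (16 * rho ^+ 2))); last first.
  by rewrite -rn2; have := rho0; move: rho => r r0; field; rewrite gt_eqF.
rewrite (_ : - (kappa ^+ 2 * n%:R) / (32 * rho ^+ 2) =
   - ((kappa ^+ 2 * n%:R) / (16 * rho ^+ 2)) / 2); last first.
  by have := rho0; move: rho => r r0; field; rewrite gt_eqF.
lra.
Qed.

End Concentration.

(** * Elementary inequalities for the rates *)

Section Rates.
Context {R : realType}.

(** [r ^+ d] is the deviation and [Num.max K r] the truncation level. If [r <= K], the first entry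
    of the minimum suffices; otherwise the second gives [r^2 r^(2(d-1)) = r^(2d)], and [1 <= K]. *)
Lemma truncation_rate (K r : R) d : (0 < d)%N -> 1 <= K -> 0 < r ->
  Num.min ((r ^+ d) ^+ 2) (r ^+ 2) * (Num.max K r ^+ d.-1) ^+ 2
    <= (r ^+ d) ^+ 2 * (K ^+ d.-1) ^+ 2.
Proof.
case: d => // d _ K1 r0 /=; have [rK|Kr] := leP r K.
  by rewrite ler_wpM2r ?sqr_ge0 // ge_min lexx.
apply: (@le_trans _ _ (r ^+ 2 * (r ^+ d) ^+ 2)).
  by rewrite ler_wpM2r ?sqr_ge0 // ge_min lexx orbT.
by rewrite -exprMn -exprS ler_peMr ?sqr_ge0 // -exprM exprn_ege1.
Qed.

(** With [r = (t/2)^(1/d)], halving [t] costs a factor 4 in [t^2] and [2^(2/d) <= 4] in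
    [t^(2/d)]. *)
Lemma half_rate (t : R) d : (0 < d)%N -> 0 < t ->
  exists r, [/\ 0 < r, r ^+ d = t / 2 &
   Num.min (t ^+ 2) (t `^ (2 / d%:R)) <= 4 * Num.min ((r ^+ d) ^+ 2) (r ^+ 2)].
Proof.
move=> d0 t0; have t20 : 0 < t / 2 by rewrite divr_gt0.
have dN : d%:R != 0 :> R by rewrite pnatr_eq0 -lt0n.
exists ((t / 2) `^ d%:R^-1); have rE : ((t / 2) `^ d%:R^-1) ^+ d = t / 2.
  by rewrite -powR_mulrn ?powR_ge0 // -powRrM mulVf // powRr1 // ltW.
split => //; first exact: powR_gt0.
rewrite rE minr_pMr // ; set r := (t / 2) `^ _.
have -> : 4 * (t / 2) ^+ 2 = t ^+ 2 by field.
have h : t `^ (2 / d%:R) <= 4 * r ^+ 2.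
  rewrite mulrC powRrM [t `^ _ `^ _]powR_mulrn ?powR_ge0 //.
  have {1}-> : t = 2 * (t / 2) by field.
  rewrite powRM // ?(ltW t20) // exprMn -/r ler_wpM2r ?sqr_ge0 //.
  rewrite (_ : 4 = 2 ^+ 2); last by ring.
  rewrite ler_pXn2r ?nnegrE ?powR_ge0 // -[leRHS]powRr1 // ler_powR ?ler1n //.
  by rewrite invf_le1 ?ltr0n // ler1n.
by rewrite le_min !ge_min lexx h orbT.
Qed.

(** If [1 <= 2 * y] the conclusion is trivial; otherwise [D y^m <= (2y)^m <= 1], which leaves one
    factor [y]. *)
Lemma absorb_prefactor (p D y : R) m : p <= 1 -> 0 <= y -> 0 <= D -> D <= 2 ^+ m ->
  p <= 2 * D * y ^+ m.+1 -> p <= 2 * y.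
Proof.
move=> p1 y0 D0 Dm hp; have [y2|y2] := leP 1 (2 * y); first exact: le_trans y2.
apply: le_trans hp _; rewrite -mulrA ler_pM2l // exprS mulrCA ler_piMr //.
apply: (@le_trans _ _ (2 ^+ m * y ^+ m)); first by rewrite ler_wpM2r ?exprn_ge0.
by rewrite -exprMn exprn_ile1 ?mulr_ge0 // ltW.
Qed.

End Rates.

(** * From the truncated bound to deviations from the median *)

Section Deviation.
Context {R : realType} {dT : measure_display} {T : measurableType dT}.
Local Notation C := (complex R).
Variable P : probability T R.
Variables (n L : nat) (X : T -> 'I_L -> 'M[C]_n) (rho : R).
Hypothesis n0 : (0 < n)%N.
Hypothesis rho0 : 0 < rho.
Hypothesis mX : forall l, mx_measurable (fun w => X w l).
Hypothesis cX : forall l k, P.-integrable setT (fun w => (mxcoord (X w l) k)%:E) /\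
   (\int[P]_w (mxcoord (X w l) k)%:E = 0)%E.
Hypothesis concX : subgauss_conc P X rho.

(** The smaller of the two rates in [truncated_deviation], with [kappa] in the first replaced by its
    least admissible value. *)
Definition rate_const (L d : nat) (rho : R) : R :=
  Num.min ((poly_lip L d + 1) ^+ 2 * ((1 + 48 * rho) ^+ d.-1) ^+ 2 * rho ^+ 2)^-1
          (32 * rho ^+ 2)^-1.

Lemma rate_const_gt0 d : 0 < rate_const L d rho.
Proof.
have K0 : 0 < poly_lip L d + 1 :> R by rewrite ltr_wpDl // poly_lip_ge0.
by rewrite lt_min !invr_gt0 !mulr_gt0 ?exprn_gt0 // addr_gt0 // mulr_gt0.
Qed.

(** The level [kappa = max(K, r)] serves both exponents: [truncation_rate] handles the first, and
    [r^2 <= kappa^2] the second. *)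
Lemma deviation_from_center d (A : nc_coeffs R n L d) (F : 'M[C]_n -> R) (r : R) :
  (0 < d)%N ->
  (forall k ii eps j, op_norm (A k ii eps j) <= 1) ->
  (forall x y, `|F x - F y| <= hs_norm (x - y)) -> 0 < r ->
  let Y w := nc_poly A (fun l => (((Num.sqrt (n%:R : R))^-1)%:C)%C *: X w l) in
  exists a : R,
   (P [set w | (r ^+ d <= `|F (Y w) - a|)%R] <=
     ((2 + 2 * L%:R) * expR (- (rate_const L d rho * n%:R *
        Num.min ((r ^+ d) ^+ 2) (r ^+ 2))))%:E)%E.
Proof.
move=> d0 A1 lipF r0 Y; set u := Num.min _ (r ^+ 2).
set K := 1 + 48 * rho; have K1 : 1 <= K by rewrite lerDl mulr_ge0 // ltW.
pose kappa := Num.max K r.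
have n0r : (0 : R) < n%:R by rewrite ltr0n.
have [|a ha] := truncated_deviation n0 rho0 mX cX concX A1 lipF (kappa := kappa)
  _ (exprn_gt0 d r0); first by rewrite le_max lexx.
exists a; apply: le_trans ha _; rewrite lee_fin [leRHS]mulrDl.
have u0 : 0 <= u by rewrite le_min !sqr_ge0.
have kap0 : 0 < kappa by rewrite lt_max r0 orbT.
have Kp0 : 0 < poly_lip L d + 1 :> R by rewrite ltr_wpDl // poly_lip_ge0.
apply: lerD.
  rewrite ler_pM2l // ler_expR mulNr lerN2.
  rewrite ler_pdivlMr ?mulr_gt0 ?exprn_gt0 //.
  have h := truncation_rate d0 K1 r0; rewrite -/u -/kappa in h.
  apply: (@le_trans _ _ (((poly_lip L d + 1) ^+ 2 * (K ^+ d.-1) ^+ 2 * rho ^+ 2)^-1 * n%:R * u *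
     ((poly_lip L d + 1) ^+ 2 * kappa ^+ d.-1 ^+ 2 * rho ^+ 2))).
    apply: ler_wpM2r; first by rewrite mulr_ge0 ?sqr_ge0 // mulr_ge0 ?sqr_ge0.
    apply: ler_wpM2r => //; apply: ler_wpM2r; first exact: ltW.
    by rewrite ge_min lexx.
  have q0 : 0 < K ^+ d.-1 by rewrite exprn_gt0 // (lt_le_trans ltr01).
  move: h q0 Kp0; move: (K ^+ d.-1) (kappa ^+ d.-1) (_ + 1) => q q' B h q0 B0.
  rewrite (_ : _ * n%:R * u * _ = n%:R * (u * q' ^+ 2 / q ^+ 2)); last first.
    by have := rho0; move: rho => rh rh0; field; rewrite !gt_eqF.
  by rewrite mulrC ler_pM2r // ler_pdivrMr // exprn_gt0.
rewrite ler_wpM2l ?mulr_ge0 // ler_expR mulNr lerN2.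
apply: (@le_trans _ _ ((32 * rho ^+ 2)^-1 * n%:R * u)).
  rewrite ler_wpM2r // ler_wpM2r ?(ltW n0r) //; by rewrite ge_min lexx orbT.
rewrite -mulrA [leRHS]mulrC; apply: ler_wpM2l; first by rewrite invr_ge0 mulr_ge0 ?sqr_ge0.
rewrite mulrC ler_pM2r //.
apply: (@le_trans _ _ (r ^+ 2)); first by rewrite ge_min lexx orbT.
by rewrite ler_pXn2r ?nnegrE ?(ltW r0) ?(ltW kap0) // le_max lexx orbT.
Qed.

(** Either [D * e] is at least 1/2 and the doubled prefactor makes the bound trivial, or deviating
    by [t / 2] from [a] has probability below 1/2. Then [med] is within [t / 2] of [a], and a
    deviation of [t] from [med] is one of at least [t / 2] from [a]. *)
Lemma deviation_from_median d (A : nc_coeffs R n L d) (F : 'M[C]_n -> R) (t med : R) :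
  (0 < d)%N ->
  (forall k ii eps j, op_norm (A k ii eps j) <= 1) ->
  (forall x y, `|F x - F y| <= hs_norm (x - y)) -> 0 < t ->
  let Y w := nc_poly A (fun l => (((Num.sqrt (n%:R : R))^-1)%:C)%C *: X w l) in
  is_median P (F \o Y) med ->
   (P [set w | (t <= `|F (Y w) - med|)%R] <=
     (2 * (2 + 2 * L%:R) * expR (- (rate_const L d rho / 4 * n%:R *
        Num.min (t ^+ 2) (t `^ (2 / d%:R)))))%:E)%E.
Proof.
move=> d0 A1 lipF t0 Y hmed.
have [r [r0 rt hu]] := half_rate d0 t0.
have [a ha] := deviation_from_center d0 A1 lipF r0.
move: ha hu; rewrite -/Y rt => ha hu.
set D := 2 + 2 * L%:R in ha *; set u := Num.min _ (r ^+ 2) in ha hu.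
have D0 : 0 < D by rewrite ltr_wpDr.
set U := Num.min _ _.
set e := expR (- (rate_const L d rho / 4 * n%:R * U)).
have eE : expR (- (rate_const L d rho * n%:R * u)) <= e.
  rewrite ler_expR lerN2 (_ : _ / 4 * n%:R * U = rate_const L d rho * n%:R * (U / 4)); last by field.
  rewrite ler_wpM2l ?mulr_ge0 ?(ltW (rate_const_gt0 d)) //.
  by rewrite ler_pdivrMr // mulrC.
have e0 : 0 < e by exact: expR_gt0.
have ha' : (P [set w | (t / 2 <= `|F (Y w) - a|)%R] <= (D * e)%:E)%E.
  by apply: le_trans ha _; rewrite lee_fin ler_wpM2l // ltW.
have mFY : measurable_fun setT (F \o Y).
  by apply: hs_lipschitz_measurable lipF; apply: mx_measurable_poly => l; exact: mx_measurable_scale.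
have [small|big] := ltP (D * e) 2^-1; last first.
  apply: le_trans (probability_le1 _ _) _; first exact: measurable_deviation.
  by rewrite lee_fin -mulrA -ler_pdivrMl // mulr1.
have am : `|med - a| < t / 2.
  apply: median_close hmed _ => //; apply: le_lt_trans ha' _.
  by rewrite lte_fin.
apply: (@le_trans _ _ (P [set w | (t / 2 <= `|F (Y w) - a|)%R])).
  apply: le_measure; rewrite ?inE.
  - exact: measurable_deviation.
  - exact: measurable_deviation.
  move=> w /= hw.
  have := ler_distD a (F (Y w)) med; rewrite [`|a - med|]distrC => h.
  rewrite leNgt; apply/negP => hlt; move: h; rewrite leNgt => /negP; apply.
  by apply: lt_le_trans hw; rewrite [ltRHS]splitr ltrD.
apply: le_trans ha' _; rewrite lee_fin -mulrA ler_peMl ?ler1n //.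
by apply: mulr_ge0; exact: ltW.
Qed.

End Deviation.

Theorem theorem3p19 (R : realType) (d L : nat) (rho : R) :
  (0 < d)%N -> (0 < L)%N -> 0 < rho ->
  exists c : R, 0 < c /\
  forall (n : nat) (dT : measure_display) (T : measurableType dT)
    (P : probability T R) (X : T -> 'I_L -> 'M[complex R]_n)
    (A : nc_coeffs R n L d),
    (0 < n)%N ->
    (* measurability of real and imaginary parts of all entries *)
    (forall l a b, measurable_fun setT (fun w => complex.Re (X w l a b))) ->
    (forall l a b, measurable_fun setT (fun w => complex.Im (X w l a b))) ->
    (* centered *)
    (forall l a b, P.-integrable setT (fun w => (complex.Re (X w l a b))%:E) /\
                   ('E_P[fun w => complex.Re (X w l a b)] = 0)%E) ->
    (forall l a b, P.-integrable setT (fun w => (complex.Im (X w l a b))%:E) /\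
                   ('E_P[fun w => complex.Im (X w l a b)] = 0)%E) ->
    subgauss_conc P X rho ->
    (forall k ii eps j, op_norm (A k ii eps j) <= 1) ->
    let Y := fun w => nc_poly A (fun l => (((Num.sqrt (n%:R : R))^-1)%:C)%C *: X w l) in
    forall F : 'M[complex R]_n -> R,
      (forall x y, `|F x - F y| <= hs_norm (x - y)) ->
      forall t : R, 0 < t -> forall med : R, is_median P (F \o Y) med ->
        (P [set w | (`|F (Y w) - med| >= t)%R] <=
           (2 * expR (- (c * n%:R * Order.min (t ^+ 2) (t `^ (2 / d%:R)))))%:E)%E.
Proof.
(* [m] is the number [D = 2 + 2L] in the prefactor, so [D <= 2 ^+ m]; dividing the rate by [m.+1]
   makes the previous exponential the power [m.+1] of the new one, as [absorb_prefactor]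
   requires. *)
move=> d0 _ rho0; pose m := (2 + 2 * L)%N.
pose c0 := rate_const L d rho / 4.
have c00 : 0 < c0 by rewrite divr_gt0 // rate_const_gt0.
exists (c0 / m.+1%:R); split; first by rewrite divr_gt0.
move=> n dT T P X A n0 mRe mIm cRe cIm concX A1 Y F lipF t t0 med hmed.
have mX l : mx_measurable (fun w => X w l) by move=> a b; split.
have cX l k : P.-integrable setT (fun w => (mxcoord (X w l) k)%:E) /\
   (\int[P]_w (mxcoord (X w l) k)%:E = 0)%E.
  case: k => [[a b] []].
    by case: (cIm l a b) => ii; rewrite unlock.
  by case: (cRe l a b) => ii; rewrite unlock.
have := deviation_from_median n0 rho0 mX cX concX d0 A1 lipF t0 hmed.
set B := [set w | _]; set U := Num.min _ _.
have mB : measurable B.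
  apply: measurable_deviation; apply: hs_lipschitz_measurable lipF.
  by apply: mx_measurable_poly => l; exact: mx_measurable_scale.
rewrite -(fineK (fin_num_measure P _ mB)) !lee_fin -/c0 => h.
apply: (absorb_prefactor (m := m) (D := 2 + 2 * L%:R)) => //.
- by rewrite -lee_fin fineK ?fin_num_measure // probability_le1.
- by rewrite -natrM -natrD -natrX ler_nat ltnW // ltn_expl.
apply: le_trans h _; rewrite ler_pM2l ?mulr_gt0 ?ltr_wpDr //.
rewrite -expRM_natl ler_expR mulrN lerN2 mulrA mulrA [X in X * _ * _]mulrC divfK //.
Qed.
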